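(* Let $X,Y,A,B$ and $R$ be finite sets, $\xi\in\mathbb C^{XY}\otimes\mathbb C^R$ a unit vector, and $P=\sum_k\lambda_k\gamma_k\gamma_k^*$ with $(\gamma_k)_k$ an orthonormal family in $\mathbb C^{AB}\otimes\mathbb C^R$ and $0\le\lambda_k\le1$. Regard $\xi\xi^*\otimes P$ as an element of $\mathcal S_1^X(M_A)\otimes\mathcal S_1^Y(M_B)\otimes M_R\otimes M_R$ and set $\mathbb G=\overline{({\rm id}\otimes\phi_R)(\xi\xi^*\otimes P)}$, where $\phi_R:M_R\otimes M_R\to\mathbb C$, $a\otimes b\mapsto{\rm Tr}(ab)$. Then (i) $\omega_{\rm loc}(\xi,P)=\|\mathbb G\|_{\mathcal S_1^X(M_A)\otimes_\varepsilon\mathcal S_1^Y(M_B)}$ and (ii) $\omega_{\rm q}(\xi,P)=\|\mathbb G\|_{\mathcal S_1^X(M_A)\otimes_{\min}\mathcal S_1^Y(M_B)}$.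
   Context: The overline is entrywise complex conjugation in standard bases. The element $\xi\xi^*\otimes P\in M_X\otimes M_Y\otimes M_R\otimes M_A\otimes M_B\otimes M_R$ is reshuffled into $(M_X\otimes M_A)\otimes(M_Y\otimes M_B)\otimes M_R\otimes M_R$ (the first $M_R$ from $\xi\xi^*$, the second from $P$). $\mathcal S_1^A$ denotes $M_A$ with the operator space structure making $(\mathcal S_1^A)^*=M_A$ via $\langle S,T\rangle={\rm Tr}(ST)$ completely isometric; $\mathcal S_1^X(M_A)$ is the operator space dual of $M_X\otimes_{\min}\mathcal S_1^A$, identified with $M_X\otimes M_A$ via the pairing $\langle S\otimes T,S'\otimes T'\rangle={\rm Tr}(SS'){\rm Tr}(TT')$; similarly $\mathcal S_1^Y(M_B)$. $\otimes_{\min}$ is the minimal operator space tensor product and $\otimes_\varepsilon$ the Banach injective tensor product. A stochastic operator matrix over $(X,A)$ on $H$ is a positive $E=(E_{x,x',a,a'})\in M_{XA}(\mathcal B(H))$ with $\sum_aE_{x,x',a,a}=\delta_{x,x'}I_H$. $\mathcal Q_{\rm q}$ is the set of maps $\Gamma:M_{XY}\to M_{AB}$, $\Gamma(\epsilon_{x,x'}\otimes\epsilon_{y,y'})=\sum\langle(\tilde E_{x,x',a,a'}\otimes\tilde F_{y,y',b,b'})\zeta,\zeta\rangle\epsilon_{a,a'}\otimes\epsilon_{b,b'}$, for finite dimensional $H_A,H_B$, a unit vector $\zeta\in H_A\otimes H_B$ and stochastic operator matrices $\tilde E$ over $(X,A)$ on $H_A$ and $\tilde F$ over $(Y,B)$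 on $H_B$; $\mathcal Q_{\rm loc}$ is the set of convex combinations of $\Phi\otimes\Psi$ with channels $\Phi:M_X\to M_A$, $\Psi:M_Y\to M_B$. For ${\rm t}\in\{{\rm q,loc}\}$, $\omega_{\rm t}(\xi,P)=\sup_{\Gamma\in\mathcal Q_{\rm t}}{\rm Tr}((\Gamma\otimes{\rm id}_R)(\xi\xi^* )P)$. *)

(* Defs.v *)
From mathcomp Require Import all_boot all_order all_algebra.
From mathcomp Require Import complex.
From mathcomp Require Import classical_sets reals.
Unset Strict Implicit. Unset Printing Implicit Defensive.
Import Order.TTheory GRing.Theory Num.Theory.
Local Open Scope ring_scope.

(* Scalars: R a real type (complete archimedean ordered field), C := R[i].
   Finite sets are finTypes.  A "matrix" over a finite index set K is a
   function K -> K -> C; an element of M_I(M_K) is a function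
   I -> I -> K -> K -> C (block (i,j) is the K x K matrix U i j). *)

Section Defs.
Variable R : realType.
Local Notation C := (R[i]).

Definition reC (z : C) : R := let: Complex a _ := z in a.
Definition abs2 (z : C) : R := let: Complex a b := z in a ^+ 2 + b ^+ 2.
Definition cabs (z : C) : R := Num.sqrt (abs2 z).
Definition rC (r : R) : C := Complex r 0.

Definition vn2 (I : finType) (v : I -> C) : R := \sum_(i : I) abs2 (v i).

Definition opnorm (I : finType) (M : I -> I -> C) : R :=
  sup [set r : R | exists v : I -> C,
        vn2 I v <= 1 /\ r = Num.sqrt (vn2 I (fun i => \sum_(j : I) M i j * v j))].

Definition psd (I : finType) (M : I -> I -> C) : Prop :=
  forall v : I -> C, 0 <= \sum_(i : I) \sum_(j : I) (v i)^* * M i j * v j.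

(* An operator space structure on the vector space M_K (K x K matrices) is given
   by its matrix norms: for every finite index set I, a norm on M_I(M_K). *)
Definition mnorms (K : finType) :=
  forall I : finType, (I -> I -> K -> K -> C) -> R.

(* the standard (C*-algebra) structure of M_K : M_I(M_K) = M_{I x K} *)
Definition mn_mat (K : finType) : mnorms K :=
  fun I U => opnorm _ (fun p q : I * K => U p.1 q.1 p.2 q.2).

(* cb norm of the linear map E -> M_P, e |-> (sum_{k,k'} L p p' k k' e k k')_{p,p'},
   where E = M_K carries the structure nE *)
Definition cbnorm (K : finType) (nE : mnorms K) (P : finType)
    (L : P -> P -> K -> K -> C) : R :=
  sup [set r : R | exists (I : finType) (U : I -> I -> K -> K -> C),
        nE I U <= 1 /\
        r = mn_mat P I (fun i j p p' => \sum_(k : K) \sum_(k' : K) L p p' k k' * U i j k k')].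

Definition tpair (K : finType) (S T : K -> K -> C) : C :=
  \sum_(k : K) \sum_(k' : K) S k k' * T k' k.

(* operator space dual of (M_K, nE), identified with M_K via the trace pairing:
   M_I(E^* ) = CB(E, M_I), T |-> (e |-> (<T_ij, e>)_{ij}) *)
Definition mn_dual (K : finType) (nE : mnorms K) : mnorms K :=
  fun I T => cbnorm K nE I (fun i j k k' => T i j k' k).

(* minimal operator space tensor product of (M_K1, nE) and (M_K2, nF), the
   algebraic tensor product being identified with M_{K1 x K2} via
   (e (x) f) (k1,k2) (k1',k2') = e k1 k1' * f k2 k2'.
   ||u||_{M_I(E (x)_min F)} = sup over complete contractions
   phi : E -> M_P, psi : F -> M_Q of ||(id_I (x) phi (x) psi)(u)||. *)
Definition mintensor (K1 K2 : finType) (nE : mnorms K1) (nF : mnorms K2)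
  : mnorms (K1 * K2)%type :=
  fun I u => sup [set r : R | exists (P Q : finType)
      (L1 : P -> P -> K1 -> K1 -> C) (L2 : Q -> Q -> K2 -> K2 -> C),
      cbnorm K1 nE P L1 <= 1 /\ cbnorm K2 nF Q L2 <= 1 /\
      r = mn_mat (P * Q)%type I (fun i j (pq pq' : P * Q) =>
             \sum_(k1 : K1) \sum_(k1' : K1) \sum_(k2 : K2) \sum_(k2' : K2)
               L1 pq.1 pq'.1 k1 k1' * L2 pq.2 pq'.2 k2 k2' * u i j (k1, k2) (k1', k2'))].

Definition norm1 (K : finType) (nE : mnorms K) (e : K -> K -> C) : R :=
  nE (unit : finType) (fun _ _ => e).

Definition dualnorm (K : finType) (nE : mnorms K) (f : K -> K -> C) : R :=
  sup [set r : R | exists e : K -> K -> C,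
        norm1 K nE e <= 1 /\ r = cabs (\sum_(k : K) \sum_(k' : K) f k k' * e k k')].

Definition epsnorm (K1 K2 : finType) (nE : mnorms K1) (nF : mnorms K2)
    (u : K1 * K2 -> K1 * K2 -> C) : R :=
  sup [set r : R | exists (f : K1 -> K1 -> C) (g : K2 -> K2 -> C),
        dualnorm K1 nE f <= 1 /\ dualnorm K2 nF g <= 1 /\
        r = cabs (\sum_(k1 : K1) \sum_(k1' : K1) \sum_(k2 : K2) \sum_(k2' : K2)
                    f k1 k1' * g k2 k2' * u (k1, k2) (k1', k2'))].

Definition S1 (A : finType) : mnorms A := mn_dual A (mn_mat A).

(* S_1^X(M_A) : operator space dual of M_X (x)_min S_1^A, identified with
   M_X (x) M_A = M_{X x A} via <S (x) T, S' (x) T'> = Tr(S S') Tr(T T'),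
   i.e. the trace pairing on M_{X x A}. *)
Definition S1M (X A : finType) : mnorms (X * A)%type :=
  mn_dual (X * A)%type (mintensor X A (mn_mat X) (S1 A)).

(* A linear map Gamma : M_{XY} -> M_{AB} is encoded by its values on matrix units:
   Gamma(eps_{x,x'} (x) eps_{y,y'}) = the matrix gam x x' y y' over A x B. *)
Definition corr (X Y A B : finType) :=
  X -> X -> Y -> Y -> A * B -> A * B -> C.

Definition stoch_opmx (X A H : finType) (E : X -> X -> A -> A -> H -> H -> C) : Prop :=
  psd _ (fun (p q : X * A * H) => E p.1.1 q.1.1 p.1.2 q.1.2 p.2 q.2) /\
  forall x x' h h', \sum_(a : A) E x x' a a h h' =
                    if (x == x') && (h == h') then 1 else 0.

Definition Qq (X Y A B : finType) (gam : corr X Y A B) : Prop :=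
  exists (HA HB : finType) (zeta : HA * HB -> C)
         (E : X -> X -> A -> A -> HA -> HA -> C)
         (F : Y -> Y -> B -> B -> HB -> HB -> C),
    vn2 _ zeta = 1 /\ stoch_opmx X A HA E /\ stoch_opmx Y B HB F /\
    forall x x' y y' a a' b b',
      gam x x' y y' (a, b) (a', b') =
      \sum_(h : HA * HB) \sum_(h' : HA * HB)
         E x x' a a' h.1 h'.1 * F y y' b b' h.2 h'.2 * zeta h' * (zeta h)^*.

(* quantum channel M_X -> M_A, Phi(eps_{x,x'}) = the matrix phi x x' *)
Definition channel (X A : finType) (phi : X -> X -> A -> A -> C) : Prop :=
  (forall (I : finType) (Z : I * X -> I * X -> C), psd _ Z ->
     psd _ (fun p q : I * A => \sum_(x : X) \sum_(x' : X) Z (p.1, x) (q.1, x') * phi x x' p.2 q.2))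
  /\
  (forall x x', \sum_(a : A) phi x x' a a = if x == x' then 1 else 0).

Definition Qloc (X Y A B : finType) (gam : corr X Y A B) : Prop :=
  exists (n : nat) (t : 'I_n -> R)
         (phi : 'I_n -> X -> X -> A -> A -> C) (psi : 'I_n -> Y -> Y -> B -> B -> C),
    (forall i, 0 <= t i) /\ \sum_(i < n) t i = 1 /\
    (forall i, channel X A (phi i)) /\ (forall i, channel Y B (psi i)) /\
    forall x x' y y' a a' b b',
      gam x x' y y' (a, b) (a', b') = \sum_(i < n) rC (t i) * phi i x x' a a' * psi i y y' b b'.

(* Tr((Gamma (x) id_R)(xi xi^* ) P), xi : C^{XY} (x) C^R, P on C^{AB} (x) C^R *)
Definition game_value (X Y A B Rr : finType) (gam : corr X Y A B)
    (xi : X * Y * Rr -> C) (P : A * B * Rr -> A * B * Rr -> C) : C :=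
  \sum_(s : A * B * Rr) \sum_(s' : A * B * Rr)
    (\sum_(x : X) \sum_(x' : X) \sum_(y : Y) \sum_(y' : Y)
       xi (x, y, s.2) * (xi (x', y', s'.2))^* * gam x x' y y' s.1 s'.1) * P s' s.

(* omega_t(xi, P) = sup over Gamma in Q_t (the value is real; we take Re) *)
Definition omega (X Y A B Rr : finType) (Q : corr X Y A B -> Prop)
    (xi : X * Y * Rr -> C) (P : A * B * Rr -> A * B * Rr -> C) : R :=
  sup [set r : R | exists gam : corr X Y A B, Q gam /\ r = reC (game_value X Y A B Rr gam xi P)].

(* G = conj((id (x) phi_R)(xi xi^* (x) P)) in S_1^X(M_A) (x) S_1^Y(M_B),
   phi_R(a (x) b) = Tr(a b); index ((x,a),(y,b)), ((x',a'),(y',b')) *)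
Definition GG (X Y A B Rr : finType)
    (xi : X * Y * Rr -> C) (P : A * B * Rr -> A * B * Rr -> C)
    : (X * A) * (Y * B) -> (X * A) * (Y * B) -> C :=
  fun p q =>
    (\sum_(r : Rr) \sum_(r' : Rr)
       xi (p.1.1, p.2.1, r) * (xi (q.1.1, q.2.1, r'))^*
       * P (p.1.2, p.2.2, r') (q.1.2, q.2.2, r))^*.

Definition mkP (Kk AB : finType) (lam : Kk -> R) (gma : Kk -> AB -> C) : AB -> AB -> C :=
  fun s s' => \sum_(k : Kk) rC (lam k) * gma k s * (gma k s')^*.

End Defs.

(* Main.v *)
(* Proof idea. A map [S_1^X(M_A) -> M_P] has completely bounded norm at most 1 exactly
   when the map [M_A -> M_P (x) M_X] with the same (suitably transposed) coefficients
   preserves contractions at all matrix levels; for functionals the norm suffices.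
   Unital completely positive such maps are the stochastic operator matrices, and for
   them the form of the image of [G] at [zeta] is the value of the game; this gives
   the lower bounds on the norms.
   For the upper bounds, every complete contraction is an off-diagonal corner of a
   2x2 completely positive map with unital diagonal (Haagerup, Paulsen, Wittstock).
   By positivity of [xi xi^* (x) P], Cauchy-Schwarz then bounds each matrix
   coefficient of the image of [G] by the average of two values of the game.
   The corner representation is obtained by extending a positive functional from the
   operator system of matrices [[rho (x) 1, W], [W^*, sigma (x) 1]] (M. Riesz). *)
Require Import Defs.
From mathcomp Require Import all_boot all_order all_algebra.
From mathcomp Require Import complex.
From mathcomp Require Import boolp classical_sets reals.
From mathcomp Require Import ring lra.
Import Order.TTheory GRing.Theory Num.Theory.
Local Open Scope ring_scope.

Set Implicit Arguments.
Unset Strict Implicit.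

(** * Sesquilinear forms and positive semidefinite matrices *)

(** [sup] is 0 on an unbounded set, so a member is known to lie below the supremum only after the
    set has been bounded. This is why norms come with crude entrywise bounds, uniform in the
    auxiliary index sets ([ctr_rscale], [ctr_lmap], [game_mx_bound]), and why each operator space
    structure is shown to satisfy [slices]. Once bounded, a norm enters through its unit ball, and
    the unit balls are all expressed by the one predicate [ctr]. The 2x2 extension does not enlarge
    the auxiliary spaces: its diagonal blocks act on the index sets of the given complete
    contraction. Hence one domination lemma gives both upper bounds, spaces of arbitrary finite
    dimension yielding (ii) and spaces of dimension one yielding (i). Finitely many one-dimensional
    extension steps suffice, since the hermitian matrices have a finite spanning family. *)

Section Forms.
Variable R : realType.
Local Notation C := (R[i]).
Implicit Types I J K : finType.

Lemma sum_pair (V : nmodType) I J (F : I * J -> V) :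
  \sum_p F p = \sum_i \sum_j F (i, j).
Proof. by rewrite pair_bigA; apply: eq_bigr => -[]. Qed.

(** Pushforward of a vector, the adjoint of pulling back indices: reindexing a matrix by [f] and [g]
    amounts to evaluating its form at pushed vectors ([qf_push]). For injective [f] it is an
    isometry. *)
Definition push I J (f : I -> J) (v : I -> C) : J -> C :=
  fun j => \sum_(i | f i == j) v i.

Lemma sum_push I J (f : I -> J) (v : I -> C) (F : J -> C) :
  \sum_j F j * push f v j = \sum_i F (f i) * v i.
Proof.
rewrite [RHS](partition_big f xpredT) //=; apply: eq_bigr => j _.
by rewrite big_distrr /=; apply: eq_bigr => i /eqP ->.
Qed.

Definition qf I (M : I -> I -> C) (v w : I -> C) : C :=
  \sum_i \sum_j (v i)^* * M i j * w j.

Definition n2 I (v : I -> C) : C := \sum_i (v i)^* * v i.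

Lemma eq_qf I (M N : I -> I -> C) v w v' w' :
  (forall i j, M i j = N i j) -> v =1 v' -> w =1 w' -> qf M v w = qf N v' w'.
Proof.
by move=> e ev ew; apply: eq_bigr => i _; apply: eq_bigr => j _; rewrite e ev ew.
Qed.

Lemma qfDl I (M : I -> I -> C) v v' w :
  qf M (fun i => v i + v' i) w = qf M v w + qf M v' w.
Proof.
rewrite -big_split; apply: eq_bigr => i _; rewrite -big_split; apply: eq_bigr => j _.
by rewrite rmorphD !mulrDl.
Qed.

Lemma qfDr I (M : I -> I -> C) v w w' :
  qf M v (fun i => w i + w' i) = qf M v w + qf M v w'.
Proof.
rewrite -big_split; apply: eq_bigr => i _; rewrite -big_split; apply: eq_bigr => j _.
by rewrite mulrDr.
Qed.

Lemma qfZl I (M : I -> I -> C) c v w :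
  qf M (fun i => c * v i) w = c^* * qf M v w.
Proof.
rewrite big_distrr; apply: eq_bigr => i _; rewrite big_distrr; apply: eq_bigr => j _.
by rewrite rmorphM /= -!mulrA.
Qed.

Lemma qfZr I (M : I -> I -> C) c v w :
  qf M v (fun i => c * w i) = c * qf M v w.
Proof.
rewrite big_distrr; apply: eq_bigr => i _; rewrite big_distrr; apply: eq_bigr => j _.
by rewrite mulrCA.
Qed.

Lemma qfMD I (M N : I -> I -> C) v w :
  qf (fun i j => M i j + N i j) v w = qf M v w + qf N v w.
Proof.
rewrite -big_split; apply: eq_bigr => i _; rewrite -big_split; apply: eq_bigr => j _.
by rewrite mulrDr mulrDl.
Qed.

Lemma qfMZ I (M : I -> I -> C) c v w :
  qf (fun i j => c * M i j) v w = c * qf M v w.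
Proof.
rewrite big_distrr; apply: eq_bigr => i _; rewrite big_distrr; apply: eq_bigr => j _.
by rewrite /=; ring.
Qed.

Lemma qfMsum I T (M : T -> I -> I -> C) (s : seq T) v w :
  qf (fun i j => \sum_(t <- s) M t i j) v w = \sum_(t <- s) qf (M t) v w.
Proof.
rewrite exchange_big; apply: eq_bigr => i _; rewrite exchange_big; apply: eq_bigr => j _.
by rewrite big_distrr big_distrl.
Qed.

Lemma qf_push I J (f g : I -> J) (M : J -> J -> C) v w :
  qf (fun i j => M (f i) (g j)) v w = qf M (push f v) (push g w).
Proof.
rewrite /qf; under [RHS]eq_bigr => j _ do rewrite sum_push.
rewrite exchange_big [RHS]exchange_big; apply: eq_bigr => j _ /=.
rewrite -[RHS]conjCK rmorph_sum /=.
under [in RHS]eq_bigr => i _ do rewrite !rmorphM /= conjCK -mulrA mulrC.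
rewrite (sum_push f v (fun i => (M i (g j))^* * (w j)^*)) rmorph_sum.
by apply: eq_bigr => i _; rewrite !rmorphM /= !conjCK; ring.
Qed.

Definition delta I (i : I) : I -> C := fun j => (i == j)%:R.

Lemma sum_delta I (i : I) (F : I -> C) : \sum_j (i == j)%:R * F j = F i.
Proof.
rewrite (bigD1 i) //= eqxx mul1r big1 ?addr0 // => j ne.
by rewrite eq_sym (negPf ne) mul0r.
Qed.

Lemma qf_delta I (M : I -> I -> C) i j : qf M (delta i) (delta j) = M i j.
Proof.
rewrite /qf -(sum_delta i (fun i => M i j)); apply: eq_bigr => k _.
rewrite -(sum_delta j (M k)) big_distrr; apply: eq_bigr => l _.
by rewrite /delta conjC_nat -mulrA [M k l * _]mulrC.
Qed.

Lemma n2_ge0 I (v : I -> C) : 0 <= n2 v.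
Proof. by apply: sumr_ge0 => i _; rewrite mulrC mul_conjC_ge0. Qed.

Lemma n2_push I J (f : I -> J) v : injective f -> n2 (push f v) = n2 v.
Proof.
move=> inj; rewrite /n2 (sum_push f v (fun j => (push f v j)^*)).
apply: eq_bigr => i _; congr (_^* * _).
by rewrite /push (big_pred1 i) // => k; rewrite (inj_eq inj).
Qed.

Lemma n2Z I c (v : I -> C) : n2 (fun i => c * v i) = `|c| ^+ 2 * n2 v.
Proof.
rewrite /n2 big_distrr; apply: eq_bigr => i _ /=.
by rewrite rmorphM /= normCKC; ring.
Qed.

Lemma eq_n2 I (v w : I -> C) : v =1 w -> n2 v = n2 w.
Proof. by move=> e; apply: eq_bigr => i _; rewrite e. Qed.

(** At [c = - z^* / |z|] the two last terms add up to [- 2 |z|]. This turns positivity of a form,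
    tested with all phases, into a bound on a modulus. *)
Lemma phase_le (s z : C) :
  (forall c, `|c| = 1 -> 0 <= s + c * z + (c * z)^*) -> `|z| *+ 2 <= s.
Proof.
move=> h; have [e|z0] := eqVneq z 0.
  by have := h 1 (normr1 _); rewrite e mulr0 rmorph0 !addr0 normr0 mul0rn.
have nz : `|z| != 0 by rewrite normr_eq0.
have := h (- (z^* / `|z|)).
rewrite normrN normrM normfV normr_id norm_conjC divff // => /(_ erefl).
have -> : - (z^* / `|z|) * z = - `|z|.
  by apply: (mulfI nz); rewrite mulrN -expr2 normCK; field.
rewrite rmorphN /= (conj_Creal (normr_real z)).
by rewrite -addrA -opprD subr_ge0 -mulr2n.
Qed.

Local Notation psd M := (psd R _ M).

Lemma eq_psd I (M N : I -> I -> C) : (forall i j, M i j = N i j) -> psd M -> psd N.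
Proof. by move=> e h v; have := h v; rewrite -/(qf M v v) (eq_qf e (frefl v) (frefl v)). Qed.

Lemma psd_push I J (f : I -> J) (M : J -> J -> C) :
  psd M -> psd (fun i j => M (f i) (f j)).
Proof. by move=> h v; rewrite -/(qf _ _ _) qf_push; apply: h. Qed.

Lemma psdD I (M N : I -> I -> C) : psd M -> psd N -> psd (fun i j => M i j + N i j).
Proof. by move=> h k v; rewrite -/(qf _ _ _) qfMD addr_ge0 ?h ?k. Qed.

Lemma psdZ I (M : I -> I -> C) c : 0 <= c -> psd M -> psd (fun i j => c * M i j).
Proof. by move=> c0 h v; rewrite -/(qf _ _ _) qfMZ mulr_ge0 ?h. Qed.

Lemma psd_rank1 I (u : I -> C) : psd (fun i j => u i * (u j)^*).
Proof.
move=> v; suff -> : \sum_i \sum_j (v i)^* * (u i * (u j)^*) * v j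
   = (\sum_i (u i)^* * v i) * (\sum_i (u i)^* * v i)^* by exact: mul_conjC_ge0.
rewrite mulrC rmorph_sum big_distrl; apply: eq_bigr => i _.
rewrite big_distrr; apply: eq_bigr => j _.
by rewrite rmorphM /= conjCK; ring.
Qed.

(** In C, being nonnegative includes being real, so the form is real at every vector; polarization
    with the scalars 1 and ['i] gives the symmetry. *)
Lemma psd_herm I (M : I -> I -> C) i j : psd M -> (M i j)^* = M j i.
Proof.
move=> h.
have re v : (qf M v v)^* = qf M v v by apply: conj_Creal; apply: ger0_real; exact: h.
pose A := qf M (delta i) (delta j); pose B := qf M (delta j) (delta i).
have pol c : (c * A + c^* * B)^* = c * A + c^* * B.
  have := re (fun k => delta i k + c * delta j k).
  rewrite qfDl !qfDr !qfZl !qfZr -/A -/B !rmorphD /= !re.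
  rewrite !rmorphM /= !re !conjCK -/A -/B => e.
  set a := qf M _ _ in e; set b := qf M (delta j) _ in e.
  apply: (addrI (a + c * (c^* * b))).
  by transitivity (a + c^* * A^* + (c * B^* + c * (c^* * b))); [ring | rewrite e; ring].
have := pol 1; have := pol 'i.
rewrite !rmorphD !rmorphM /= !conjCK conjCi rmorph1 !mul1r !mulNr => e2 e1.
have i0 : 'i != 0 :> C by exact: neq0Ci.
have e3 : - A^* + B^* = A - B.
  by apply: (mulfI i0); rewrite mulrDr mulrN [in RHS]mulrBr -e2.
have : A^* *+ 2 = B *+ 2.
  have -> : A^* *+ 2 = (A^* + B^*) - (- A^* + B^*) by ring.
  by rewrite e1 e3; ring.
by move/eqP; rewrite eqrMn2r //= => /eqP; rewrite /A /B !qf_delta.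
Qed.

End Forms.

Arguments delta {R I} i _.

(** * Spectral consequences *)

Section Spectral.
Local Open Scope sesquilinear_scope.
Local Notation psd M := (psd _ _ M).
Variable R : realType.
Local Notation C := (R[i]).
Implicit Types I J K : finType.

(** The spectral theorem for normal matrices, transported along the enumeration of [I]. Evaluating
    the form at a conjugated row of [U] returns its eigenvalue, hence the sign of [d]. *)
Lemma psd_spectral I (M : I -> I -> C) : psd M ->
  exists (d : I -> C) (U : I -> I -> C), (forall n, 0 <= d n) /\
   [/\ forall i j, M i j = \sum_n d n * ((U n i)^* * U n j),
     forall n m, \sum_i U n i * (U m i)^* = (n == m)%:R
   & forall i j, \sum_n (U n i)^* * U n j = (i == j)%:R].
Proof.
move=> h.
pose er := @enum_rank I; pose ev := @enum_val I (mem I).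
have erK : cancel er ev by exact: enum_rankK.
have evK : cancel ev er by exact: enum_valK.
have evb : {on [pred i : I | true], bijective ev} by exists er => x _; rewrite ?erK ?evK.
have reind (F : I -> C) : \sum_i F i = \sum_(n < #|I|) F (ev n) by rewrite (reindex ev).
pose A : 'M[C]_#|I| := \matrix_(i, j) M (ev i) (ev j).
have An : A \is normalmx.
  apply/normalmxP; suff -> : A^t* = A by [].
  by apply/matrixP => i j; rewrite !mxE; apply: psd_herm.
have Aeq := orthomx_spectralP An.
set P := spectralmx A in Aeq; set D := spectral_diag A in Aeq.
have Pu : P \is unitarymx := spectral_unitarymx A.
have PP : P *m P^t* = 1%:M by apply/unitarymxP.
have PP2 : P^t* *m P = 1%:M by apply: mulmx1C.
rewrite invmx_unitary // in Aeq.
pose U n i := P (er n) (er i); pose d n := D 0 (er n).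
have U1 n m : \sum_i U n i * (U m i)^* = (n == m)%:R.
  have := congr1 (fun X : 'M_#|I| => X (er n) (er m)) PP; rewrite !mxE (inj_eq (can_inj erK)) => <-.
  by rewrite reind; apply: eq_bigr => k _; rewrite !mxE /U evK.
have U2 i j : \sum_n (U n i)^* * U n j = (i == j)%:R.
  have := congr1 (fun X : 'M_#|I| => X (er i) (er j)) PP2; rewrite !mxE (inj_eq (can_inj erK)) => <-.
  by rewrite reind; apply: eq_bigr => k _; rewrite !mxE /U evK.
have ME i j : M i j = \sum_n d n * ((U n i)^* * U n j).
  have := congr1 (fun X : 'M_#|I| => X (er i) (er j)) Aeq.
  rewrite /A !mxE !erK => ->; rewrite reind; apply: eq_bigr => k _.
  rewrite mul_mx_diag !mxE /U /d evK; ring.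
exists d, U; split=> // n.
have := h (fun j => (U n j)^*).
suff -> : \sum_i \sum_j ((U n i)^*)^* * M i j * (U n j)^* = d n by [].
transitivity (\sum_m d m * ((\sum_i U n i * (U m i)^*) * (\sum_j U m j * (U n j)^*))).
  under eq_bigr => i _ do under eq_bigr => j _ do rewrite ME conjCK big_distrr big_distrl /=.
  under eq_bigr => i _ do rewrite exchange_big /=.
  rewrite exchange_big /=; apply: eq_bigr => m _.
  rewrite big_distrlr /= big_distrr /=; apply: eq_bigr => i _.
  by rewrite big_distrr /=; apply: eq_bigr => j _; ring.
rewrite -[RHS](sum_delta n d); apply: eq_bigr => m _; rewrite !U1 [m == n]eq_sym.
by case: eqP; rewrite ?mulr1 ?mul1r // !mulr0 mul0r.
Qed.

Lemma psd_gram I (M : I -> I -> C) : psd M ->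
  exists w : I -> I -> C, forall i j, M i j = \sum_n w n i * (w n j)^*.
Proof.
move=> /psd_spectral [d] [U] [d0 [ME _ _]].
exists (fun n i => sqrtC (d n) * (U n i)^*) => i j; rewrite ME; apply: eq_bigr => n _.
have s0 : 0 <= sqrtC (d n) by rewrite sqrtC_ge0.
rewrite rmorphM /= conjCK (conj_Creal (ger0_real s0)) -{1}[d n]sqrtCK; ring.
Qed.

(** The shift by [e] makes every eigenvalue strictly positive, so that the root [r] has a two-sided
    inverse [s]. *)
Lemma psd_sqrt I (M : I -> I -> C) e : psd M -> 0 < e ->
  exists r s : I -> I -> C,
   [/\ forall i j, M i j + e * (i == j)%:R = \sum_n r i n * (r j n)^*,
       forall i j, \sum_n r i n * s n j = (i == j)%:R
     & forall n m, \sum_i s n i * r i m = (n == m)%:R].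
Proof.
move=> /psd_spectral [d] [U] [d0 [ME U1 U2]] e0.
have de n : 0 < d n + e by rewrite ltr_wpDl.
have s0 n : 0 < sqrtC (d n + e) by rewrite sqrtC_gt0.
have s1 n : sqrtC (d n + e) != 0 by rewrite gt_eqF.
exists (fun i n => sqrtC (d n + e) * (U n i)^*), (fun n i => (sqrtC (d n + e))^-1 * U n i).
split=> i j.
- rewrite ME -U2 big_distrr -big_split /=; apply: eq_bigr => n _.
  rewrite rmorphM /= conjCK (conj_Creal (ger0_real (ltW (s0 n)))).
  have := sqrtCK (d n + e); set q := sqrtC _ => E.
  transitivity ((d n + e) * ((U n i)^* * U n j)); first by ring.
  by rewrite -E; ring.
- rewrite -U2; apply: eq_bigr => n _.
  by rewrite mulrACA divff ?mul1r.
- transitivity ((sqrtC (d i + e))^-1 * sqrtC (d j + e) * \sum_n U i n * (U j n)^*).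
    by rewrite big_distrr; apply: eq_bigr => n _ /=; ring.
  by rewrite U1; case: eqP => [->|]; rewrite ?mulr0 // mulr1 mulVf.
Qed.

(** A Gram decomposition of the second factor turns the form of the product into a sum of forms of
    the first. *)
Lemma psd_kron I J (M : I -> I -> C) (N : J -> J -> C) :
  psd M -> psd N -> psd (fun p q : I * J => M p.1 q.1 * N p.2 q.2).
Proof.
move=> hM /psd_gram [w hN] t.
suff -> : \sum_p \sum_q (t p)^* * (M p.1 q.1 * N p.2 q.2) * t q =
   \sum_n qf M (fun i => \sum_j (w n j)^* * t (i, j)) (fun i => \sum_j (w n j)^* * t (i, j)).
  by apply: sumr_ge0 => n _; apply: hM.
rewrite /qf [RHS]exchange_big sum_pair /=; apply: eq_bigr => i _.
rewrite [RHS]exchange_big /=.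
under eq_bigr => j _ do rewrite sum_pair.
rewrite exchange_big /=; apply: eq_bigr => i' _.
under [RHS]eq_bigr => n _ do rewrite rmorph_sum /= big_distrl big_distrlr /=.
rewrite [RHS]exchange_big /=; apply: eq_bigr => j _.
rewrite [RHS]exchange_big /=; apply: eq_bigr => j' _.
rewrite hN big_distrr big_distrr big_distrl /=; apply: eq_bigr => n _.
by rewrite rmorphM /= conjCK; ring.
Qed.

End Spectral.

(** * Contractions and completely contractive maps *)

Section Contractions.
Local Notation psd M := (psd _ _ M).
Variable R : realType.
Local Notation C := (R[i]).
Implicit Types I J K A P Q : finType.

(** Operator norm at most 1 ([opnorm1P]), stated without square roots: by rescaling the vectors, the
    bound by the product of their norms is equivalent to the bound by the mean of the squares. *)
Definition ctr I (M : I -> I -> C) := forall v w, `|qf M v w| *+ 2 <= n2 v + n2 w.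

Lemma eq_ctr I (M N : I -> I -> C) : (forall i j, M i j = N i j) -> ctr M -> ctr N.
Proof. by move=> e h v w; rewrite -(eq_qf e (frefl v) (frefl w)). Qed.

(** Pushing forward along an injection is isometric. Separate injections for rows and columns cover
    off-diagonal submatrices as well as reshufflings of product index sets. *)
Lemma ctr_inj I J (f g : I -> J) (M : J -> J -> C) :
  injective f -> injective g -> ctr M -> ctr (fun i j => M (f i) (g j)).
Proof.
by move=> injf injg h v w; rewrite qf_push -(n2_push v injf) -(n2_push w injg).
Qed.

Lemma ctr_conj I (M : I -> I -> C) : ctr M -> ctr (fun i j => (M i j)^*).
Proof.
move=> h v w; have := h (fun i => (v i)^*) (fun i => (w i)^*).
have e (u : I -> C) : n2 (fun i => (u i)^*) = n2 u.
  by apply: eq_bigr => i _; rewrite conjCK mulrC.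
rewrite !e => le; apply: le_trans le; rewrite -norm_conjC le_eqVlt; apply/orP; left; apply/eqP.
congr (`|_| *+ 2); rewrite rmorph_sum; apply: eq_bigr => i _; rewrite rmorph_sum.
by apply: eq_bigr => j _; rewrite !rmorphM /= !conjCK.
Qed.

(** The source of all crude norm bounds: a matrix is written as a combination of known
    contractions. *)
Lemma ctr_comb I T (s : seq T) (a : T -> C) (M : T -> I -> I -> C) :
  (forall t, ctr (M t)) -> \sum_(t <- s) `|a t| <= 1 ->
  ctr (fun i j => \sum_(t <- s) a t * M t i j).
Proof.
move=> h sa v w; rewrite (qfMsum (fun t i j => a t * M t i j)).
under eq_bigr => t _ do rewrite qfMZ.
have s0 : 0 <= n2 v + n2 w by rewrite addr_ge0 ?n2_ge0.
apply: (@le_trans _ _ (\sum_(t <- s) `|a t| * (`|qf (M t) v w| *+ 2))).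
  apply: (@le_trans _ _ ((\sum_(t <- s) `|a t * qf (M t) v w|) *+ 2)).
    by rewrite ler_wMn2r // ler_norm_sum.
  by rewrite -sumrMnl; apply: ler_sum => t _; rewrite normrM mulrnAr.
apply: (@le_trans _ _ (\sum_(t <- s) `|a t| * (n2 v + n2 w))).
  by apply: ler_sum => t _; apply: ler_wpM2l => //; apply: h.
by rewrite -big_distrl /= ler_piMl.
Qed.

Lemma ctr_unit I (a b : I) : ctr (fun i j => (a == i)%:R * (b == j)%:R : C).
Proof.
move=> v w.
have -> : qf (fun i j => (a == i)%:R * (b == j)%:R) v w = (v a)^* * w b.
  rewrite -(sum_delta a (fun i => (v i)^* * w b)); apply: eq_bigr => i _.
  rewrite -(sum_delta b w) !big_distrr; apply: eq_bigr => j _ /=; ring.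
have le (u : I -> C) i : (u i)^* * u i <= n2 u.
  rewrite /n2 (bigD1 i) //= lerDl sumr_ge0 // => k _.
  by rewrite mulrC mul_conjC_ge0.
apply: le_trans (lerD (le v a) (le w b)).
apply: phase_le => c c1.
have := mul_conjC_ge0 (v a + c * w b); congr (0 <= _).
rewrite rmorphD !rmorphM /= !conjCK.
have cc : c * c^* = 1 by rewrite -normCK c1 expr1n.
transitivity ((v a)^* * v a + (c * c^*) * ((w b)^* * w b) + c * ((v a)^* * w b) + c^* * (v a * (w b)^*)).
  by ring.
by rewrite cc; ring.
Qed.

Lemma ctr_delta I : ctr (fun i j : I => (i == j)%:R : C).
Proof.
move=> v w.
have -> : qf (fun i j => (i == j)%:R) v w = \sum_i (v i)^* * w i.
  apply: eq_bigr => i _; rewrite -(sum_delta i w) big_distrr.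
  by apply: eq_bigr => j _ /=; rewrite mulrA.
apply: phase_le => c c1.
rewrite big_distrr rmorph_sum -!big_split; apply: sumr_ge0 => i _.
have := mul_conjC_ge0 (v i + c * w i); congr (0 <= _).
rewrite rmorphD !rmorphM /= !conjCK.
have cc : c * c^* = 1 by rewrite -normCK c1 expr1n.
transitivity ((v i)^* * v i + (c * c^*) * ((w i)^* * w i) + c * ((v i)^* * w i) + c^* * (v i * (w i)^*)).
  by ring.
by rewrite cc; ring.
Qed.

(** The matrix is [U] tensored with a matrix unit, so its form only sees the slice of [v] at [p] and
    that of [w] at [p']. *)
Lemma ctr_emb I P (p p' : P) (U : I -> I -> C) : ctr U ->
  ctr (fun x y : I * P => (p == x.2)%:R * (p' == y.2)%:R * U x.1 y.1).
Proof.
move=> h v w.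
have -> : qf (fun x y : I * P => (p == x.2)%:R * (p' == y.2)%:R * U x.1 y.1) v w
   = qf U (fun i => v (i, p)) (fun i => w (i, p')).
  rewrite /qf sum_pair; apply: eq_bigr => i _.
  rewrite -(sum_delta p (fun p => \sum_j (v (i, p))^* * U i j * w (j, p'))).
  apply: eq_bigr => q _; rewrite sum_pair big_distrr; apply: eq_bigr => j _ /=.
  rewrite -(sum_delta p' (fun p' => w (j, p'))) !big_distrr; apply: eq_bigr => q' _ /=; ring.
have le (u : I * P -> C) q : n2 (fun i => u (i, q)) <= n2 u.
  rewrite /n2 sum_pair; apply: ler_sum => i _.
  rewrite (bigD1 q) //= lerDl sumr_ge0 // => k _.
  by rewrite mulrC mul_conjC_ge0.
by apply: le_trans (h _ _) _; rewrite lerD.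
Qed.

Lemma addJ_le (z : C) : - (z + z^*) <= `|z| *+ 2.
Proof.
have zr : - (z + z^*) \is Num.real.
  by apply/CrealP; rewrite rmorphN rmorphD /= conjCK addrC.
apply: le_trans (real_ler_norm zr) _; rewrite normrN mulr2n.
by apply: le_trans (ler_normD _ _) _; rewrite norm_conjC.
Qed.

Lemma sum_delta2 K (F : K -> K -> C) a b :
  \sum_k \sum_k' F k k' * ((a == k)%:R * (b == k')%:R) = F a b.
Proof.
rewrite -(sum_delta a (fun a => F a b)); apply: eq_bigr => k _.
rewrite -(sum_delta b (F k)) big_distrr; apply: eq_bigr => k' _ /=; ring.
Qed.

Lemma n2_delta I (i : I) : n2 (delta i : I -> C) = 1.
Proof.
rewrite /n2 -(sum_delta i (fun=> 1)); apply: eq_bigr => l _.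
by rewrite /delta conjC_nat mulr1 -natrM mulnb andbb.
Qed.

Lemma ctr_entry I (M : I -> I -> C) i j : ctr M -> `|M i j| <= 1.
Proof.
move=> /(_ (delta i) (delta j)); rewrite qf_delta.
by rewrite !n2_delta -mulr2n lerMn2r.
Qed.

Lemma n2_eq0 I (v : I -> C) : n2 v = 0 -> forall i, v i = 0.
Proof.
move/eqP; rewrite psumr_eq0 => [/allP H i|i _]; last by rewrite mulrC mul_conjC_ge0.
by have /implyP/(_ isT) := H i (mem_index_enum i); rewrite mulrC mul_conjC_eq0 => /eqP.
Qed.

Lemma ctr_sphere I (M : I -> I -> C) :
  (forall v w, n2 v = 1 -> n2 w = 1 -> `|qf M v w| <= 1) -> ctr M.
Proof.
move=> h v w.
have s0 : 0 <= n2 v + n2 w by rewrite addr_ge0 ?n2_ge0.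
have [v0|vn] := eqVneq (n2 v) 0.
  rewrite /qf big1 ?normr0 ?mul0rn // => i _; rewrite big1 // => j _.
  by rewrite (n2_eq0 v0) rmorph0 !mul0r.
have [w0|wn] := eqVneq (n2 w) 0.
  rewrite /qf big1 ?normr0 ?mul0rn // => i _; rewrite big1 // => j _.
  by rewrite (n2_eq0 w0) mulr0.
have unit (u : I -> C) : n2 u != 0 -> n2 (fun i => (sqrtC (n2 u))^-1 * u i) = 1.
  move=> un; rewrite n2Z normfV exprVn ger0_norm ?sqrtC_ge0 ?n2_ge0 //.
  by rewrite sqrtCK mulVf.
have := h _ _ (unit _ vn) (unit _ wn); rewrite qfZl qfZr.
have p (u : I -> C) : n2 u != 0 -> 0 < sqrtC (n2 u).
  by move=> un; rewrite sqrtC_gt0 lt_neqAle eq_sym un n2_ge0.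
have pv := p _ vn; have pw := p _ wn.
rewrite !normrM norm_conjC !normfV (gtr0_norm pv) (gtr0_norm pw) mulrA -invfM mulrC ler_pdivrMr ?mulr_gt0 // mul1r => le.
have /(le_trans _) -> // : sqrtC (n2 v) * sqrtC (n2 w) *+ 2 <= n2 v + n2 w.
  rewrite -{2}[n2 v]sqrtCK -{2}[n2 w]sqrtCK.
  set a := sqrtC _; set b := sqrtC _.
  have ar : a - b \is Num.real by rewrite realB // gtr0_real.
  have := real_exprn_even_ge0 (n := 2) ar isT; rewrite sqrrB => le2.
  by rewrite -subr_ge0; move: le2; congr (0 <= _); ring.
by rewrite lerMn2r.
Qed.

(** The matrix [[1, W], [W^*, 1]], with [true] for the first block; it is positive exactly when [W]
    is a contraction ([psd_bblock], [bblock_ctr]). *)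
Definition bblock I (W : I -> I -> C) (p q : bool * I) : C :=
  if p.1 == q.1 then (p.2 == q.2)%:R
  else if p.1 then W p.2 q.2 else (W q.2 p.2)^*.

Lemma sum_bool (F : bool -> C) : \sum_b F b = F true + F false.
Proof. by rewrite big_bool. Qed.

Lemma qf_bblock I (W : I -> I -> C) v :
  let a i := v (true, i) in let b i := v (false, i) in
  qf (bblock W) v v = n2 a + n2 b + (qf W a b + (qf W a b)^*).
Proof.
move=> a b.
have d (u : I -> C) : \sum_i \sum_j (u i)^* * (i == j)%:R * u j = n2 u.
  apply: eq_bigr => i _; rewrite -[X in _ = _ * X](sum_delta i u) big_distrr.
  by apply: eq_bigr => j _ /=; rewrite mulrA.
transitivity (\sum_i \sum_j ((a i)^* * (i == j)%:R * a j + (b i)^* * (i == j)%:R * b j +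
    ((a i)^* * W i j * b j + (b i)^* * (W j i)^* * a j))).
  rewrite /qf sum_pair sum_bool -big_split; apply: eq_bigr => i _ /=.
  rewrite !sum_pair !sum_bool -!big_split; apply: eq_bigr => j _ /=.
  rewrite /bblock /= /a /b; ring.
under eq_bigr => i _ do rewrite !big_split /=.
rewrite !big_split /= !d; congr (_ + (_ + _)).
rewrite exchange_big rmorph_sum; apply: eq_bigr => i _; rewrite rmorph_sum.
apply: eq_bigr => j _; rewrite !rmorphM /= conjCK; ring.
Qed.

Lemma psd_bblock I (W : I -> I -> C) : ctr W -> psd (bblock W).
Proof.
move=> h v; rewrite -/(qf _ _ _) qf_bblock.
have := le_trans (addJ_le _) (h (fun i => v (true, i)) (fun i => v (false, i))).
by rewrite -subr_ge0 opprK.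
Qed.

Lemma ctr_bblock I (W : I -> I -> C) :
  (forall a b, 0 <= n2 a + n2 b + qf W a b + (qf W a b)^*) -> ctr W.
Proof.
move=> h v w; apply: phase_le => c c1.
have := h v (fun i => c * w i).
by rewrite n2Z c1 expr1n mul1r qfZr rmorphM.
Qed.

(** Testing the contraction at the pair [M v], [v] gives [2 n2 (M v) <= n2 (M v) + n2 v]. *)
Lemma ctr_n2 I (M : I -> I -> C) v : ctr M -> n2 (fun i => \sum_j M i j * v j) <= n2 v.
Proof.
move=> h; pose w i := \sum_j M i j * v j.
have e : qf M w v = n2 w.
  apply: eq_bigr => i _; rewrite {3}/w big_distrr; apply: eq_bigr => j _ /=; ring.
have := h w v; rewrite e ger0_norm ?n2_ge0 // mulr2n lerD2l; exact.
Qed.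

Lemma bblock_ctr I (W : I -> I -> C) : psd (bblock W) -> ctr W.
Proof.
move=> h; apply: ctr_bblock => a b.
have := h (fun p => if p.1 then a p.2 else b p.2).
by rewrite -/(qf _ _ _) qf_bblock addrA.
Qed.

Lemma ctr_scale I (M : I -> I -> C) (s : C) :
  \sum_p `|M p.1 p.2| <= s -> 0 < s -> ctr (fun i j => s^-1 * M i j).
Proof.
move=> hs s0.
have := @ctr_comb I (I * I)%type (index_enum _) (fun p => s^-1 * M p.1 p.2)
  (fun p i j => (p.1 == i)%:R * (p.2 == j)%:R) (fun p => @ctr_unit I p.1 p.2).
have -> : \sum_p `|s^-1 * M p.1 p.2| = s^-1 * \sum_p `|M p.1 p.2|.
  rewrite big_distrr; apply: eq_bigr => p _ /=.
  by rewrite normrM ger0_norm // invr_ge0 ltW.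
rewrite mulrC ler_pdivrMr // mul1r => /(_ hs); apply: eq_ctr => i j.
rewrite sum_pair /= -(sum_delta i (fun i => s^-1 * M i j)); apply: eq_bigr => k _.
rewrite -(sum_delta j (M k)) !big_distrr; apply: eq_bigr => l _ /=.
by rewrite [i == k]eq_sym [j == l]eq_sym; ring.
Qed.

(** [c k k' a a'] is the entry at [k], [k'] of the image of a matrix unit under a map M_A -> M_K;
    [amp] applies that map to the M_A factor of [W] and leaves M_Q fixed. [ccmap] below is thus
    complete contractivity. *)
Definition amp K A (c : K -> K -> A -> A -> C) Q (W : Q * A -> Q * A -> C)
  (p q : K * Q) : C := \sum_a \sum_a' c p.1 q.1 a a' * W (p.2, a) (q.2, a').

Definition ccmap K A (c : K -> K -> A -> A -> C) : Prop :=
  forall Q (W : Q * A -> Q * A -> C), ctr W -> ctr (amp c W).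

Lemma ccmap_slice K A (c : K -> K -> A -> A -> C) a a' :
  ccmap c -> ctr (fun k k' => c k k' a a').
Proof.
move=> h.
have W : ctr (fun p q : unit * A => (a == p.2)%:R * (a' == q.2)%:R : C).
  apply: eq_ctr (@ctr_inj (unit * A)%type A snd snd _ _ _ (ctr_unit a a')) => //;
  by move=> [[] ?] [[] ?] /= ->.
have := h _ _ W.
move=> /(@ctr_inj K _ (fun k => (k, tt)) (fun k => (k, tt))) H.
apply: eq_ctr (H _ _) => [i j|i j [] //|i j [] //].
by rewrite /amp /= sum_delta2.
Qed.

(** The Choi matrix of a unital completely positive map M_A -> M_K. For K = H x X it is a stochastic
    operator matrix over (X, A) on H. *)
Definition stoch K A (E : K -> K -> A -> A -> C) : Prop :=
  psd (fun p q : K * A => E p.1 q.1 p.2 q.2) /\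
  forall k k', \sum_a E k k' a a = (k == k')%:R.

(** Applied to the positive matrix [[1, W], [W^*, 1]], a unital completely positive map gives a
    positive matrix of the same shape with [amp E W] in the corner. *)
Lemma stoch_ccmap K A (E : K -> K -> A -> A -> C) : stoch E -> ccmap E.
Proof.
move=> [hE tr] Q W hW; apply: ctr_bblock => u w.
pose f (x : bool * K * Q * A) : (K * A) * (bool * (Q * A)) :=
  ((x.1.1.2, x.2), (x.1.1.1, (x.1.2, x.2))).
(* Compressing the Kronecker product to a common A-index, at a vector that does not depend on it,
   evaluates the amplified map at [bblock W]. *)
have := psd_push f (psd_kron hE (psd_bblock hW)).
pose uw (b : bool) := if b then u else w.
move=> /(_ (fun x => uw x.1.1.1 (x.1.1.2, x.1.2))); congr (0 <= _).
pose T b b' : C := \sum_k \sum_q \sum_k' \sum_q' \sum_a \sum_a'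
   (uw b (k, q))^* * (E k k' a a' * bblock W (b, (q, a)) (b', (q', a'))) * uw b' (k', q').
transitivity (T true true + T true false + (T false true + T false false)).
  rewrite !sum_pair sum_bool; congr (_ + _).
    rewrite /T -big_split; apply: eq_bigr => k _ /=.
    rewrite -big_split; apply: eq_bigr => q _ /=.
    under eq_bigr => a _ do rewrite !sum_pair sum_bool.
    rewrite big_split; congr (_ + _); rewrite exchange_big; apply: eq_bigr => k' _;
    under eq_bigr => a _ do rewrite /=; rewrite exchange_big; apply: eq_bigr => q' _ //.
  rewrite /T -big_split; apply: eq_bigr => k _ /=.
  rewrite -big_split; apply: eq_bigr => q _ /=.
  under eq_bigr => a _ do rewrite !sum_pair sum_bool.
  rewrite big_split; congr (_ + _); rewrite exchange_big; apply: eq_bigr => k' _;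
  under eq_bigr => a _ do rewrite /=; rewrite exchange_big; apply: eq_bigr => q' _ //.
have diag b : T b b = n2 (uw b).
  rewrite /n2 sum_pair; apply: eq_bigr => k _; apply: eq_bigr => q _.
  transitivity (\sum_k' (k == k')%:R * \sum_q' (q == q')%:R * ((uw b (k, q))^* * uw b (k', q'))); last first.
    by rewrite !sum_delta.
  apply: eq_bigr => k' _; rewrite big_distrr; apply: eq_bigr => q' _ /=.
  rewrite -tr big_distrl /=; apply: eq_bigr => a _.
  rewrite -(sum_delta a (fun a' => E k k' a a' * ((q == q')%:R * ((uw b (k, q))^* * uw b (k', q'))))).
  apply: eq_bigr => a' _; rewrite /bblock /= eqxx xpair_eqE andbC -mulnb natrM; ring.
have TF : T true false = qf (amp E W) u w.
  rewrite /qf sum_pair; apply: eq_bigr => k _; apply: eq_bigr => q _.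
  rewrite sum_pair; apply: eq_bigr => k' _; apply: eq_bigr => q' _.
  rewrite /amp big_distrr big_distrl; apply: eq_bigr => a _ /=.
  by rewrite big_distrr big_distrl; apply: eq_bigr => a' _ /=.
have FT : T false true = (T true false)^*.
  have pairT b b' : T b b' = \sum_(p : K * Q) \sum_(p' : K * Q) \sum_a \sum_a'
      (uw b p)^* * (E p.1 p'.1 a a' * bblock W (b, (p.2, a)) (b', (p'.2, a'))) * uw b' p'.
    rewrite sum_pair; apply: eq_bigr => k _; apply: eq_bigr => q _.
    by rewrite sum_pair.
  rewrite !pairT [in RHS]exchange_big rmorph_sum; apply: eq_bigr => -[k q] _ /=.
  rewrite rmorph_sum; apply: eq_bigr => -[k' q'] _ /=.
  rewrite [in RHS]exchange_big rmorph_sum; apply: eq_bigr => a _ /=.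
  rewrite rmorph_sum; apply: eq_bigr => a' _ /=.
  by rewrite !rmorphM /= conjCK (psd_herm (k', a') (k, a) hE) /bblock /=; ring.
rewrite !diag FT TF; ring.
Qed.

End Contractions.

(** * Extension of positive functionals *)

Section Riesz.
Local Notation psd M := (psd _ _ M).
Variable R : realType.
Local Notation C := (R[i]).
Local Notation "x %:C" := (real_complex R x).
Variable J : finType.
Implicit Types (B : (J -> J -> C) -> R -> Prop) (M N : J -> J -> C).

(* The graph of a real-linear functional on a real subspace of matrices. *)
Definition lin_graph B := forall M r N s c,
  B M r -> B N s -> B (fun i j => M i j + c%:C * N i j) (r + c * s).

Definition pos_graph B := forall M r, B M r -> psd M -> 0 <= r.

Definition herm M := forall i j, (M i j)^* = M j i.

(* M. Riesz: the new value is the supremum of the values on minorants of [w]. *)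
Lemma riesz_step B (w : J -> J -> C) :
  lin_graph B -> pos_graph B ->
  (forall h, herm h -> exists M r, B M r /\ psd (fun i j => M i j - h i j)) ->
  herm w ->
  exists B', [/\ lin_graph B', pos_graph B', forall M r, B M r -> B' M r
             & exists t, B' w t].
Proof.
move=> lB pB ub hw.
pose L : set R := fun r => exists M, B M r /\ psd (fun i j => w i j - M i j).
have hN : herm (fun i j => - w i j) by move=> i j; rewrite rmorphN /= hw.
have [M0 [r0 [B0 P0]]] := ub _ hw.
(* [lin_graph] provides only sums [M + c N]; the multiple of [M] by [c] is obtained as
   [M + (c - 1) M]. *)
have BZ M r c : B M r -> B (fun i j => M i j + (c - 1)%:C * M i j) (r + (c - 1) * r).
  by move=> h; apply: lB.
have Lne : (L !=set0)%classic.
  have [M [r [BM PM]]] := ub _ hN.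
  exists (r + (-1 - 1) * r), (fun i j => M i j + (-1 - 1)%:C * M i j); split; first exact: BZ.
  apply: eq_psd PM => i j; rewrite rmorphB rmorphN rmorph1; ring.
have LU r M s : L r -> B M s -> psd (fun i j => M i j - w i j) -> r <= s.
  move=> [N [BN PN]] BM PM.
  have := pB _ _ (lB _ _ _ _ (-1) BM BN).
  rewrite mulN1r subr_ge0; apply.
  by apply: eq_psd (psdD PM PN) => i j; rewrite rmorphN rmorph1; ring.
have Lub : has_ubound L by exists r0 => r Lr; apply: LU Lr B0 P0.
pose t := sup L.
pose B' M r := exists N s c, [/\ B N s, forall i j, M i j = N i j + c%:C * w i j & r = s + c * t].
exists B'; split.
- move=> M r M' r' c [N [s [d [BN EM ->]]]] [N' [s' [d' [BN' EM' ->]]]].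
  exists (fun i j => N i j + c%:C * N' i j), (s + c * s'), (d + c * d'); split.
  + exact: lB.
  + by move=> i j; rewrite EM EM' rmorphD rmorphM /=; ring.
  + by ring.
- move=> M r [N [s [c [BN EM ->]]]] PM.
  have PN : psd (fun i j => N i j + c%:C * w i j) by apply: eq_psd PM.
  have [c0|c0|c0] := ltgtP c 0.
  (* Here [(- c)^-1 N] majorizes [w], so its value bounds the value of every minorant, hence [t]. *)
  + have k0 : 0 <= (- c)^-1 :> R by rewrite invr_ge0 oppr_ge0 ltW.
    have c1 : c != 0 by rewrite lt_eqF.
    have E : c%:C * (c^-1)%:C = 1 :> C by rewrite -rmorphM /= divff.
    suff h : t <= s + ((- c)^-1 - 1) * s.
      have : 0 <= - c * (s + ((- c)^-1 - 1) * s - t).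
        by rewrite mulr_ge0 ?subr_ge0 // oppr_ge0 ltW.
      by congr (_ <= _); field; rewrite ?oppr_eq0.
    apply: ge_sup => // x Lx; apply: LU Lx (BZ _ _ _ BN) _.
    have k0' : 0 <= ((- c)^-1)%:C :> C by rewrite ler0c.
    apply: eq_psd (psdZ k0' PN) => i j.
    rewrite rmorphB rmorph1 invrN rmorphN /=.
    by transitivity (- (c^-1)%:C * N i j - (c%:C * (c^-1)%:C) * w i j); [ring|rewrite E; ring].
  (* Here [- c^-1 N] is a minorant of [w], so its value is at most [t]. *)
  + have k0 : 0 <= c^-1 :> R by rewrite invr_ge0 ltW.
    have c1 : c != 0 by rewrite gt_eqF.
    have E : c%:C * (c^-1)%:C = 1 :> C by rewrite -rmorphM /= divff.
    suff h : s + (- c^-1 - 1) * s <= t.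
      have : 0 <= c * (t - (s + (- c^-1 - 1) * s)).
        by rewrite mulr_ge0 ?subr_ge0 // ltW.
      by congr (_ <= _); field.
    apply: ub_le_sup => //; exists (fun i j => N i j + (- c^-1 - 1)%:C * N i j).
    split; first exact: BZ.
    have k0' : 0 <= (c^-1)%:C :> C by rewrite ler0c.
    apply: eq_psd (psdZ k0' PN) => i j.
    rewrite rmorphB rmorph1 rmorphN /=.
    by transitivity ((c^-1)%:C * N i j + (c%:C * (c^-1)%:C) * w i j); [ring|rewrite E; ring].
  + rewrite c0 mul0r addr0; apply: (pB N) => //.
    by apply: eq_psd PN => i j; rewrite c0 rmorph0 mul0r addr0.
- move=> M r BM; exists M, r, 0; split=> //.
    by move=> i j; rewrite rmorph0 mul0r addr0.
  by rewrite mul0r addr0.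
- exists t, (fun i j => M0 i j + (-1)%:C * M0 i j), (r0 + -1 * r0), 1; split.
  + exact: lB.
  + by move=> i j; rewrite rmorphN rmorph1; ring.
  + by ring.
Qed.

Lemma riesz_seq B (T : eqType) (w : T -> J -> J -> C) (s : seq T) :
  lin_graph B -> pos_graph B ->
  (forall h, herm h -> exists M r, B M r /\ psd (fun i j => M i j - h i j)) ->
  (forall x, herm (w x)) ->
  exists B', [/\ lin_graph B', pos_graph B', forall M r, B M r -> B' M r
    & forall x, x \in s -> exists t, B' (w x) t].
Proof.
move=> lB pB ub hw; elim: s => [|x s IH]; first by exists B.
have [B1 [l1 p1 s1 v1]] := IH.
have ub1 h : herm h -> exists M r, B1 M r /\ psd (fun i j => M i j - h i j).
  by move=> /ub [M [r [BM PM]]]; exists M, r; split=> //; apply: s1.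
have [B2 [l2 p2 s2 [t v2]]] := riesz_step l1 p1 ub1 (hw x).
exists B2; split=> // [M r /s1 /s2 //|y].
rewrite inE => /orP[/eqP -> |/v1 [u /s2 hu]]; first by exists t.
by exists u.
Qed.

Lemma lin_graph_sum B (T : eqType) (w : T -> J -> J -> C) (t c : T -> R) (s : seq T) M r :
  B M r -> lin_graph B -> (forall x, B (w x) (t x)) ->
  B (fun i j => \sum_(x <- s) (c x)%:C * w x i j) (\sum_(x <- s) c x * t x).
Proof.
move=> BM lB h; elim: s => [|x s IH].
  have := lB _ _ _ _ (-1) BM BM; rewrite big_nil mulN1r subrr.
  congr (B _ _); apply/funext => i; apply/funext => j.
  by rewrite big_nil rmorphN rmorph1; ring.
have := lB _ _ _ _ (c x) IH (h x); rewrite big_cons [in X in _ -> X]addrC.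
by congr (B _ _); apply/funext => i; apply/funext => j; rewrite big_cons addrC.
Qed.

(** Both [r - s] and [s - r] are values at the zero matrix, which is positive. *)
Lemma lin_graph_inj B M r s : lin_graph B -> pos_graph B -> B M r -> B M s -> r = s.
Proof.
move=> lB pB.
suff le r' s' : B M r' -> B M s' -> s' <= r'.
  by move=> hr hs; apply: le_anti; rewrite !le.
move=> hr hs; have := pB _ _ (lB _ _ _ _ (-1) hr hs).
rewrite mulN1r subr_ge0; apply => v.
rewrite big1 // => i _; rewrite big1 // => j _.
by rewrite rmorphN rmorph1; ring.
Qed.

Let im : C := Complex 0 1.

(** The hermitian matrices E_ij + E_ji and i (E_ij - E_ji). They are taken over all ordered pairs,
    so every matrix is counted twice: hence the factor 2 in [hbasisE] and the halves in
    [riesz_rep]. *)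
Let hbasis (x : bool * (J * J)) : J -> J -> C := fun k l =>
  let: (i, j) := x.2 in
  if x.1 then (i == k)%:R * (j == l)%:R + (j == k)%:R * (i == l)%:R
  else im * ((i == k)%:R * (j == l)%:R) - im * ((j == k)%:R * (i == l)%:R).

Lemma conj_im : im^* = - im.
Proof. by apply/eqP; rewrite eq_complex /= oppr0 !eqxx. Qed.

Lemma hbasis_herm x : herm (hbasis x).
Proof.
case: x => [b [i j]] k l; rewrite /hbasis /=; case: b.
  by rewrite rmorphD !rmorphM /= !conjC_nat; ring.
by rewrite rmorphB !rmorphM /= !conjC_nat conj_im; ring.
Qed.

Let hcoord (M : J -> J -> C) (x : bool * (J * J)) : R :=
  let z := M x.2.1 x.2.2 in if x.1 then complex.Re z else complex.Im z.

Lemma conj_ReIm (z : C) : z^* = (complex.Re z)%:C - im * (complex.Im z)%:C.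
Proof. by rewrite [z in LHS]complexE rmorphD rmorphM /= conj_im !conj_Creal ?mulNr // complex_real. Qed.

Lemma hbasisE M k l : herm M -> \sum_x (hcoord M x)%:C * hbasis x k l = M k l *+ 2.
Proof.
move=> hM.
transitivity (\sum_i \sum_j ((i == k)%:R * ((j == l)%:R * M i j) + (j == k)%:R * ((i == l)%:R * (M i j)^*))).
  rewrite sum_pair sum_bool !sum_pair -big_split; apply: eq_bigr => i _ /=.
  rewrite -big_split; apply: eq_bigr => j _ /=; rewrite /hcoord /= conj_ReIm.
  rewrite /hbasis /=; set a := (complex.Re _)%:C; set b := (complex.Im _)%:C.
  have -> : M i j = a + im * b by exact: complexE.
  by ring.
under eq_bigr => i _ do rewrite big_split /=.
rewrite big_split mulr2n; congr (_ + _) => /=.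
  rewrite -[RHS](sum_delta k (fun i => M i l)); apply: eq_bigr => i _.
  rewrite -(sum_delta l (M i)) big_distrr; apply: eq_bigr => j _ /=.
  by rewrite [k == i]eq_sym [l == j]eq_sym.
rewrite exchange_big -hM -[RHS](sum_delta k (fun i => (M l i)^*)); apply: eq_bigr => i _ /=.
rewrite -(sum_delta l (fun j => (M j i)^*)) big_distrr; apply: eq_bigr => j _ /=.
by rewrite [k == i]eq_sym [l == j]eq_sym.
Qed.

Lemma riesz_rep B :
  lin_graph B -> pos_graph B -> (forall M r, B M r -> herm M) ->
  (forall h, herm h -> exists M r, B M r /\ psd (fun i j => M i j - h i j)) ->
  exists N, psd N /\ forall M r, B M r -> \sum_i \sum_j N i j * (M i j)^* = r%:C.
Proof.
move=> lB pB hB ub.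
have [B' [l' p' s' v']] :=
  @riesz_seq B _ hbasis (enum {: bool * (J * J)}) lB pB ub hbasis_herm.
have /boolp.choice [t ht] : forall x, exists t, B' (hbasis x) t.
  by move=> x; apply: v'; rewrite mem_enum.
pose rep M := 2^-1 * \sum_x hcoord M x * t x.
have [M0 [r0 [/s' B0 _]]] := ub (fun _ _ => 0) (fun i j => rmorph0 _).
have B'rep M : herm M -> B' M (rep M).
  move=> hM; have h1 := lin_graph_sum (hcoord M) (index_enum _) B0 l' ht.
  have := l' _ _ _ _ (2^-1 - 1) h1 h1; congr (B' _ _); last by rewrite /rep; ring.
  apply/funext => i; apply/funext => j; rewrite hbasisE // rmorphB rmorph1.
  have e : (2^-1)%:C * 2 = 1 :> C.
    by rewrite -[2 in X in _ * X](rmorph_nat (real_complex R)) -rmorphM /= mulVf ?pnatr_eq0.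
  by transitivity ((2^-1)%:C * 2 * M i j); [ring | rewrite e mul1r].
(* Exchanging [i] and [j] fixes or negates the spanning matrix, and a positive graph is
   single-valued; so [N] is hermitian. *)
have t1 i j : t (true, (i, j)) = t (true, (j, i)).
  apply: (lin_graph_inj l' p' (ht _)); move: (ht (true, (j, i))); congr (B' _ _).
  by apply/funext => k; apply/funext => l; rewrite /hbasis /=; ring.
have t2 i j : t (false, (i, j)) = - t (false, (j, i)).
  apply: (lin_graph_inj l' p' (ht _)).
  have := l' _ _ _ _ (-2) (ht (false, (j, i))) (ht (false, (j, i))); congr (B' _ _); last by ring.
  by apply/funext => k; apply/funext => l; rewrite /hbasis /= rmorphN rmorph_nat; ring.
pose N i j : C := 2^-1 * ((t (true, (i, j)))%:C + im * (t (false, (i, j)))%:C).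
have conjR (x : R) : (x%:C)^* = x%:C :> C by rewrite conj_Creal // complex_real.
have conj2 : (2^-1)^* = 2^-1 :> C by rewrite fmorphV rmorph_nat.
have hN : herm N.
  by move=> i j; rewrite /N rmorphM rmorphD rmorphM /= conj_im !conjR conj2 t1 t2 rmorphN; ring.
have repE M : herm M -> \sum_i \sum_j N i j * (M i j)^* = (rep M)%:C.
  move=> hM; set S := \sum_i _.
  (* As [S] is real, [2 S = S + S^*], and this sum is compared with twice [rep M] term by term. *)
  have SS : S^* = S.
    rewrite {1}/S exchange_big rmorph_sum; apply: eq_bigr => i _; rewrite rmorph_sum.
    by apply: eq_bigr => j _; rewrite rmorphM /= conjCK hN hM.
  have two : (2 : C) != 0 by rewrite pnatr_eq0.
  apply: (mulfI two); transitivity (S + S^*); first by rewrite SS mulr_natl mulr2n.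
  have e1 : 2 * rep M = \sum_i \sum_j (hcoord M (true, (i, j)) * t (true, (i, j))
      + hcoord M (false, (i, j)) * t (false, (i, j))).
    rewrite /rep mulVKf ?pnatr_eq0 // sum_pair big_bool !sum_pair -big_split.
    by apply: eq_bigr => i _; rewrite -big_split.
  have -> : 2 * (rep M)%:C = (2 * rep M)%:C by rewrite !mulr_natl rmorphMn.
  rewrite e1 /S !rmorph_sum -big_split; apply: eq_bigr => i _.
  rewrite !rmorph_sum -big_split; apply: eq_bigr => j _ /=.
  rewrite /N !(rmorphM, rmorphD) /= conj_im !conjR conj2 !conjCK /hcoord /=.
  rewrite conj_ReIm.
  have im2 : im * im = -1 by rewrite -expr2 sqr_i.
  set x := (t (true, _))%:C; set y := (t (false, _))%:C; set a := (complex.Re _)%:C; set b := (complex.Im _)%:C.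
  have -> : M i j = a + im * b by exact: complexE.
  transitivity (2^-1 * 2 * (x * a) - 2^-1 * 2 * (im * im) * (y * b)); first by ring.
  by rewrite im2 mulVf //; ring.
exists N; split=> [v|M r BM]; last first.
  by rewrite repE ?(lin_graph_inj l' p' (s' _ _ BM) (B'rep _ (hB _ _ BM))) //; apply: hB BM.
have P1 := @psd_rank1 R J v.
have h1 : herm (fun i j => v i * (v j)^*) by move=> i j; apply: psd_herm P1.
have := p' _ _ (B'rep _ h1) P1; rewrite -ler0c -(repE _ h1); congr (0 <= _).
apply: eq_bigr => i _; apply: eq_bigr => j _; rewrite rmorphM /= conjCK; ring.
Qed.

End Riesz.

(** * Corners of completely positive maps *)

Section Wittstock.
Local Notation psd M := (psd _ _ M).
Variable R : realType.
Local Notation C := (R[i]).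
Local Notation "x %:C" := (real_complex R x).

(** Congruence by the block diagonal matrix with blocks [S t]. *)
Lemma psd_congr (T K : finType) (S : T -> K -> K -> C) (M : T * K -> T * K -> C) :
  psd M ->
  psd (fun p p' : T * K =>
    \sum_q \sum_q' S p.1 p.2 q * M (p.1, q) (p'.1, q') * (S p'.1 p'.2 q')^*).
Proof.
move=> h v.
have := h (fun p => \sum_k (S p.1 k p.2)^* * v (p.1, k)); congr (0 <= _).
rewrite !sum_pair; apply: eq_bigr => t _ /=.
under eq_bigr => q _ do rewrite sum_pair /=.
under [RHS]eq_bigr => k _ do rewrite sum_pair /=.
rewrite exchange_big [RHS]exchange_big; apply: eq_bigr => t' _ /=.
transitivity (\sum_q \sum_q' \sum_k \sum_k'
   (v (t, k))^* * (S t k q * M (t, q) (t', q') * (S t' k' q')^*) * v (t', k')).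
  apply: eq_bigr => q _; apply: eq_bigr => q' _.
  rewrite rmorph_sum big_distrl big_distrlr /=; apply: eq_bigr => k _.
  by apply: eq_bigr => k' _; rewrite rmorphM /= conjCK; ring.
rewrite exchange_big /=.
under eq_bigr => q' _ do rewrite exchange_big /=.
rewrite exchange_big /=; apply: eq_bigr => k _.
under eq_bigr => q' _ do rewrite exchange_big /=.
rewrite exchange_big /=; apply: eq_bigr => k' _.
rewrite exchange_big big_distrr big_distrl /=; apply: eq_bigr => q _.
by rewrite big_distrr big_distrl.
Qed.

Variables (K A : finType) (c : K -> K -> A -> A -> C) (a0 : A).
Let J := (bool * (K * A))%type.

(** The conjugate matches the pairing of [riesz_rep], under which the representing matrix has [c]
    itself as its corner. *)
Let offd (h : J -> J -> C) : C :=
  \sum_k \sum_k' \sum_a \sum_a' c k k' a a' * (h (true, (k, a)) (false, (k', a')))^*.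

Let diag (h : J -> J -> C) : C := \sum_b \sum_k h (b, (k, a0)) (b, (k, a0)).

(* On the matrices [[rho (x) 1, W], [W^*, sigma (x) 1]], the functional
   [Tr rho + Tr sigma + 2 Re <c, W>]. *)
Let base (h : J -> J -> C) (r : R) : Prop :=
  [/\ herm h,
     forall b k k' a a', h (b, (k, a)) (b, (k', a')) = (a == a')%:R * h (b, (k, a0)) (b, (k', a0))
   & r%:C = diag h + (offd h + (offd h)^*)].

Lemma base_lin : lin_graph base.
Proof.
move=> M r N s x [hM dM eM] [hN dN eN]; have cx : (x%:C)^* = x%:C :> C by rewrite conj_Creal // complex_real.
split.
- by move=> i j; rewrite rmorphD rmorphM /= cx hM hN.
- by move=> b k k' a a'; rewrite dM dN; ring.
rewrite rmorphD rmorphM /= eM eN.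
have -> : diag (fun i j => M i j + x%:C * N i j) = diag M + x%:C * diag N.
  rewrite /diag big_distrr -big_split; apply: eq_bigr => b _ /=.
  by rewrite big_distrr -big_split.
have -> : offd (fun i j => M i j + x%:C * N i j) = offd M + x%:C * offd N.
  rewrite /offd big_distrr -big_split; apply: eq_bigr => k _ /=.
  rewrite big_distrr -big_split; apply: eq_bigr => k' _ /=.
  rewrite big_distrr -big_split; apply: eq_bigr => a _ /=.
  rewrite big_distrr -big_split; apply: eq_bigr => a' _ /=.
  by rewrite rmorphD rmorphM /= cx; ring.
by rewrite rmorphD rmorphM /= cx; ring.
Qed.

(* Adding [e] makes [rho = r r^*] and [sigma = s s^*] invertible; then
   [W = (r (x) 1) X (s (x) 1)^*] with [X] a contraction. *)
Lemma base_pos_eps (h : J -> J -> C) (r : R) (e : C) :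
  ccmap c -> base h r -> psd h -> 0 < e -> 0 <= r%:C + e * (#|K|)%:R *+ 2.
Proof.
move=> hc [hh dh ->] ph e0.
pose D b k k' := h (b, (k, a0)) (b, (k', a0)).
have pD b : psd (D b) by exact: (psd_push (fun k => (b, (k, a0))) ph).
have [r1 [s1 [rM1 rs1 sr1]]] := psd_sqrt (pD true) e0.
have [r2 [s2 [rM2 rs2 sr2]]] := psd_sqrt (pD false) e0.
have ec : e^* = e by rewrite conj_Creal // gtr0_real.
pose r_ b := if b then r1 else r2; pose s_ b := if b then s1 else s2.
have rM b i j : D b i j + e * (i == j)%:R = \sum_n r_ b i n * (r_ b j n)^* by case: b.
have rs b i j : \sum_n r_ b i n * s_ b n j = (i == j)%:R by case: b.
have sr b n m : \sum_i s_ b n i * r_ b i m = (n == m)%:R by case: b.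
pose X (p q : K * A) : C :=
  \sum_i \sum_j s1 p.1 i * h (true, (i, p.2)) (false, (j, q.2)) * (s2 q.1 j)^*.
(* Congruence by [s1] and [s2] turns [h + e 1] into [bblock X]. *)
have hX : ctr X.
  apply: bblock_ctr.
  pose f (p : (bool * A) * K) : J := (p.1.1, (p.2, p.1.2)).
  pose he i j := h i j + e * (i == j)%:R.
  have phe : psd he.
    apply: psdD => //; apply: psdZ (ltW e0) _ => v.
    suff -> : \sum_i \sum_j (v i)^* * (i == j)%:R * v j = n2 v by exact: n2_ge0.
    apply: eq_bigr => i _; rewrite -[X in _ = _ * X](sum_delta i v) big_distrr.
    by apply: eq_bigr => j _ /=; rewrite mulrA.
  have P := psd_congr (fun t => s_ t.1) (psd_push f phe).
  pose g (p : J) : (bool * A) * K := ((p.1, p.2.2), p.2.1).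
  apply: eq_psd (psd_push g P) => -[b [k a]] [b' [k' a']]; rewrite /he /f /g /=.
  rewrite /bblock /=; case: eqP => [<-{b'}|bb'].
    transitivity ((a == a')%:R * \sum_i \sum_j s_ b k i * (D b i j + e * (i == j)%:R) * (s_ b k' j)^*).
      rewrite big_distrr; apply: eq_bigr => i _; rewrite big_distrr; apply: eq_bigr => j _ /=.
      rewrite dh -/(D b i j) !xpair_eqE eqxx /= andbC -mulnb natrM; ring.
    rewrite xpair_eqE andbC -mulnb natrM; congr (_ * _).
    transitivity (\sum_n (\sum_i s_ b k i * r_ b i n) * (\sum_j s_ b k' j * r_ b j n)^*).
      under [RHS]eq_bigr => n _ do rewrite rmorph_sum big_distrlr /=.
      rewrite [RHS]exchange_big; apply: eq_bigr => i _ /=.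
      rewrite [RHS]exchange_big; apply: eq_bigr => j _ /=.
      rewrite rM big_distrr big_distrl; apply: eq_bigr => n _ /=.
      by rewrite rmorphM /=; ring.
    under eq_bigr => n _ do rewrite !sr.
    by rewrite sum_delta conjC_nat eq_sym.
  case: b b' bb' => -[] // _.
    rewrite /X /=; apply: eq_bigr => i _; apply: eq_bigr => j _.
    by rewrite mulr0 addr0.
  rewrite /X rmorph_sum exchange_big; apply: eq_bigr => i _ /=; rewrite rmorph_sum.
  apply: eq_bigr => j _ /=; rewrite mulr0 addr0 !rmorphM /= conjCK hh; ring.
(* The roots [r1] and [r2] are read as vectors indexed by K x K, with squared norms Tr (rho + e) and
   Tr (sigma + e); the pairing with [c] becomes the form, at these vectors, of the image of the
   conjugate of [X]. *)
have off : offd h = qf (amp c (fun p q => (X p q)^*)) (fun p => r1 p.1 p.2) (fun p => r2 p.1 p.2).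
  have hE k k' a a' : h (true, (k, a)) (false, (k', a')) =
      \sum_q \sum_q' r1 k q * X (q, a) (q', a') * (r2 k' q')^*.
    transitivity (\sum_i \sum_j (k == i)%:R * ((k' == j)%:R * h (true, (i, a)) (false, (j, a')))).
      by under eq_bigr => i _ do rewrite -big_distrr /=; rewrite sum_delta sum_delta.
    transitivity (\sum_i \sum_j \sum_q \sum_q' r1 k q * s1 q i * (r2 k' q' * s2 q' j)^* * h (true, (i, a)) (false, (j, a'))).
      apply: eq_bigr => i _; apply: eq_bigr => j _.
      rewrite -(rs true) /= -(conjC_nat _ (k' == j)) -(rs false) /= rmorph_sum mulrA big_distrlr big_distrl /=.
      by apply: eq_bigr => q _; rewrite big_distrl.
    under eq_bigr => i _ do rewrite exchange_big /=.
    rewrite exchange_big; apply: eq_bigr => q _ /=.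
    under eq_bigr => i _ do rewrite exchange_big /=.
    rewrite exchange_big; apply: eq_bigr => q' _ /=.
    rewrite big_distrr big_distrl; apply: eq_bigr => i _ /=.
    rewrite big_distrr big_distrl; apply: eq_bigr => j _ /=.
    by rewrite rmorphM /=; ring.
  rewrite /qf sum_pair; apply: eq_bigr => k _.
  under [RHS]eq_bigr => q _ do rewrite sum_pair.
  rewrite [RHS]exchange_big; apply: eq_bigr => k' _ /=.
  transitivity (\sum_a \sum_a' \sum_q \sum_q' c k k' a a' * (r1 k q * X (q, a) (q', a') * (r2 k' q')^*)^*).
    apply: eq_bigr => a _; apply: eq_bigr => a' _; rewrite hE rmorph_sum big_distrr.
    by apply: eq_bigr => q _ /=; rewrite rmorph_sum big_distrr.
  under [LHS]eq_bigr => a _ do rewrite exchange_big /=.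
  rewrite [LHS]exchange_big; apply: eq_bigr => q _ /=.
  under [LHS]eq_bigr => a _ do rewrite exchange_big /=.
  rewrite [LHS]exchange_big; apply: eq_bigr => q' _ /=.
  rewrite /amp big_distrr big_distrl; apply: eq_bigr => a _ /=.
  rewrite big_distrr big_distrl; apply: eq_bigr => a' _ /=.
  by rewrite !rmorphM /= conjCK; ring.
have := le_trans (addJ_le _) (hc _ _ (ctr_conj hX) (fun p => r1 p.1 p.2) (fun p => r2 p.1 p.2)).
rewrite -off -subr_ge0 opprK; congr (0 <= _).
have n2r b : n2 (fun p : K * K => r_ b p.1 p.2) = \sum_k D b k k + e * #|K|%:R.
  rewrite /n2 sum_pair -sumr_const big_distrr -big_split; apply: eq_bigr => k _ /=.
  transitivity (D b k k + e * (k == k)%:R); last by rewrite eqxx.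
  by rewrite rM; apply: eq_bigr => n _; rewrite mulrC.
rewrite (n2r true) (n2r false) /diag sum_bool -!/(D _ _ _); ring.
Qed.

Lemma base_pos : ccmap c -> pos_graph base.
Proof.
move=> hc h r bh ph.
rewrite leNgt; apply/negP => r0.
have m0 : 0 < (#|K|.+1)%:R :> R by rewrite ltr0n.
(* With this [e] the sum [r + 2 e #|K|] is at most [r / 2 < 0]; the successor keeps the quotient
   meaningful for empty [K]. *)
pose e : R := - r / (#|K|.+1)%:R / 4.
have e0 : 0 < e by rewrite !divr_gt0 ?oppr_gt0 // ltr0n.
have e0' : 0 < e%:C :> C by rewrite ltcR.
have := base_pos_eps hc bh ph e0'.
have -> : r%:C + e%:C * #|K|%:R *+ 2 = (r + e * #|K|%:R *+ 2)%:C :> C.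
  move: (e) => y; rewrite rmorphD /= rmorphMn /= rmorphM /= rmorph_nat //.
rewrite ler0c leNgt => /negP; apply.
have le : e * #|K|%:R <= e * (#|K|.+1)%:R by rewrite ler_wpM2l ?(ltW e0) // ler_nat.
have eE : e * (#|K|.+1)%:R = - r / 4 by rewrite /e mulrAC divfK // gt_eqF.
move: le; rewrite eE; lra.
Qed.

(** The identity lies in the operator system and is an order unit: its multiple by more than the sum
    of the moduli of the entries dominates [h]. *)
Lemma base_unit (h : J -> J -> C) : herm h ->
  exists M r, base M r /\ psd (fun i j => M i j - h i j).
Proof.
move=> hh; pose s := \sum_p `|h p.1 p.2| + 1.
have s0 : 0 < s by rewrite ltr_wpDl // sumr_ge0.
have sR : s = (complex.Re s)%:C by move: (gtr0_real s0) => /complex_realP [x ->].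
pose t := complex.Re s.
exists (fun i j => t%:C * (i == j)%:R), (t * (\sum_(b : bool) #|K|%:R)).
have tc : (t%:C)^* = t%:C :> C by rewrite conj_Creal // complex_real.
split.
  split.
  - by move=> i j; rewrite rmorphM /= conjC_nat tc eq_sym.
  - by move=> b k k' a a'; rewrite !xpair_eqE !eqxx /= andbT andbC -mulnb natrM; ring.
  have -> : offd (fun i j => t%:C * (i == j)%:R) = 0.
    rewrite /offd big1 // => k _; rewrite big1 // => k' _; rewrite big1 // => a _.
    by rewrite big1 // => a' _; rewrite mulr0 rmorph0 mulr0.
  rewrite rmorph0 !addr0 rmorphM rmorph_sum /diag big_distrr; apply: eq_bigr => b _ /=.
  rewrite rmorph_nat -sumr_const big_distrr; apply: eq_bigr => k _.
  by rewrite eqxx.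
have hs : \sum_p `|h p.1 p.2| <= s by rewrite lerDl ler01.
have cs := ctr_scale hs s0.
move=> v; rewrite -/(qf _ _ _).
have -> : qf (fun i j => t%:C * (i == j)%:R - h i j) v v = s * n2 v - qf h v v.
  rewrite sR -/t -mulN1r -qfMZ; transitivity (qf (fun i j => t%:C * (i == j)%:R + -1 * h i j) v v).
    by apply: eq_qf => // i j; rewrite mulN1r.
  rewrite qfMD qfMZ; congr (_ * _ + _).
  apply: eq_bigr => i _; rewrite -[X in _ = _ * X](sum_delta i v) big_distrr.
  by apply: eq_bigr => j _ /=; rewrite mulrA.
have qr : qf h v v \is Num.real.
  apply/CrealP; rewrite {1}/qf exchange_big rmorph_sum; apply: eq_bigr => i _ /=.
  rewrite rmorph_sum; apply: eq_bigr => j _ /=.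
  by rewrite !rmorphM /= conjCK hh; ring.
rewrite subr_ge0; apply: le_trans (real_ler_norm qr) _.
have := cs v v; rewrite qfMZ normrM -mulr2n lerMn2r /= gtr0_norm ?invr_gt0 //.
by rewrite mulrC ler_pdivrMr // mulrC.
Qed.

(* The theorem of Haagerup, Paulsen and Wittstock for full matrix algebras. *)
Lemma ccmap_corner : ccmap c ->
  exists N : J -> J -> C, [/\ psd N,
    forall b, stoch (fun k k' a a' => N (b, (k, a)) (b, (k', a')))
    & forall k k' a a', N (true, (k, a)) (false, (k', a')) = c k k' a a'].
Proof.
move=> hc.
have hB M r : base M r -> herm M by case.
have [N [pN NE]] := riesz_rep base_lin (base_pos hc) hB base_unit.
have hN : herm N by move=> i j; apply: psd_herm.
(* [Y] and [Z] measure how far [N] is from the required matrix. The matrix [h] formed from them lies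
   in the operator system; evaluating the functional there, directly and through [N], makes the sum
   of squares in [key] vanish. *)
pose Y b k k' := \sum_a N (b, (k, a)) (b, (k', a)) - (k == k')%:R.
pose Z k k' a a' := N (true, (k, a)) (false, (k', a')) - c k k' a a'.
have hY b k k' : (Y b k k')^* = Y b k' k.
  rewrite rmorphB /= conjC_nat rmorph_sum eq_sym; congr (_ - _).
  by apply: eq_bigr => a _; apply: hN.
pose h (i j : J) : C := if i.1 == j.1 then (i.2.2 == j.2.2)%:R * Y i.1 i.2.1 j.2.1
  else if i.1 then Z i.2.1 j.2.1 i.2.2 j.2.2 else (Z j.2.1 i.2.1 j.2.2 i.2.2)^*.
have hh : herm h.
  case=> [b [k a]] [b' [k' a']]; rewrite /h /=; case: b b' => -[] /=.
  - by rewrite rmorphM /= conjC_nat hY eq_sym.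
  - by [].
  - by rewrite conjCK.
  - by rewrite rmorphM /= conjC_nat hY eq_sym.
have : exists r, base h r.
  pose z := diag h + (offd h + (offd h)^*).
  have zr : z \is Num.real.
    rewrite realD //.
      apply: sum_real => b _; apply: sum_real => k _.
      by apply/CrealP; rewrite hh.
    by apply/CrealP; rewrite rmorphD /= conjCK addrC.
  have [x ex] := complex_realP _ zr.
  exists x; split=> //.
  by move=> b k k' a a'; rewrite /h /= !eqxx mul1r.
move=> [r hr]; have := NE _ _ hr; case: hr => _ _ -> E.
have key : \sum_b \sum_k \sum_k' `|Y b k k'| ^+ 2
    + (\sum_k \sum_k' \sum_a \sum_a' `|Z k k' a a'| ^+ 2) *+ 2 = 0.
  have E2 : \sum_i \sum_j N i j * (h i j)^* = \sum_b \sum_k \sum_k' ((\sum_a N (b, (k, a)) (b, (k', a))) * (Y b k k')^*)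
     + (\sum_k \sum_k' \sum_a \sum_a' N (true, (k, a)) (false, (k', a')) * (Z k k' a a')^*)
     + (\sum_k \sum_k' \sum_a \sum_a' N (true, (k, a)) (false, (k', a')) * (Z k k' a a')^*)^*.
    pose T b b' := \sum_k \sum_k' \sum_a \sum_a' N (b, (k, a)) (b', (k', a')) * (h (b, (k, a)) (b', (k', a')))^*.
    transitivity (T true true + T true false + (T false true + T false false)).
      rewrite sum_pair sum_bool.
      have e b : \sum_j \sum_j0 N (b, j) j0 * (h (b, j) j0)^* = T b true + T b false.
        rewrite /T sum_pair -big_split; apply: eq_bigr => k _ /=.
        under eq_bigr => a _ do rewrite sum_pair sum_bool.
        rewrite big_split; congr (_ + _); under eq_bigr => a _ do rewrite sum_pair;
        by rewrite exchange_big.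
      by rewrite !e.
    have dT b : T b b = \sum_k \sum_k' ((\sum_a N (b, (k, a)) (b, (k', a))) * (Y b k k')^*).
      apply: eq_bigr => k _; apply: eq_bigr => k' _; rewrite big_distrl; apply: eq_bigr => a _ /=.
      rewrite -(sum_delta a (fun a' => N (b, (k, a)) (b, (k', a')) * (Y b k k')^*)).
      by apply: eq_bigr => a' _; rewrite /h /= eqxx rmorphM /= conjC_nat; ring.
    have FT : T false true = (T true false)^*.
      rewrite /T exchange_big rmorph_sum; apply: eq_bigr => k _; rewrite rmorph_sum.
      apply: eq_bigr => k' _; rewrite exchange_big rmorph_sum; apply: eq_bigr => a _; rewrite rmorph_sum.
      by apply: eq_bigr => a' _; rewrite rmorphM /= conjCK -hh conjCK -hN.
    transitivity (T true true + T false false + T true false + (T true false)^*).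
      by rewrite FT; ring.
    by rewrite !dT sum_bool.
  move: E; rewrite E2.
  have -> : diag h = \sum_b \sum_k \sum_k' (k == k')%:R * (Y b k k')^*.
    apply: eq_bigr => b _; apply: eq_bigr => k _.
    by rewrite sum_delta hY /h /= !eqxx mul1r.
  set o := offd h.
  have -> : o = \sum_k \sum_k' \sum_a \sum_a' c k k' a a' * (Z k k' a a')^* by [].
  set P := \sum_b _; set Q := \sum_k _; set P' := \sum_b _; set Q' := \sum_k _ => E.
  have -> : \sum_b \sum_k \sum_k' `|Y b k k'| ^+ 2 = P - P'.
    rewrite /P /P' -sumrB; apply: eq_bigr => b _; rewrite -sumrB; apply: eq_bigr => k _.
    by rewrite -sumrB; apply: eq_bigr => k' _; rewrite normCK -mulrBl.
  have e : \sum_k \sum_k' \sum_a \sum_a' `|Z k k' a a'| ^+ 2 = Q - Q'.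
    rewrite /Q /Q' -sumrB; apply: eq_bigr => k _; rewrite -sumrB; apply: eq_bigr => k' _.
    rewrite -sumrB; apply: eq_bigr => a _; rewrite -sumrB; apply: eq_bigr => a' _.
    by rewrite normCK -mulrBl.
  have e' : (Q - Q')^* = Q - Q'.
    by rewrite -e conj_Creal // ger0_real // !sumr_ge0 // => *; rewrite !sumr_ge0 // => *; rewrite !sumr_ge0 // => *; rewrite !sumr_ge0 // => *; rewrite exprn_ge0.
  rewrite e mulr2n -{2}e' rmorphB /=.
  transitivity (P + Q + Q^* - (P' + (Q' + Q'^*))); first by ring.
  by rewrite E subrr.
have sge (T : finType) (F : T -> C) : (forall x, 0 <= F x) -> \sum_x F x = 0 -> forall x, F x = 0.
  move=> F0 /eqP; rewrite psumr_eq0; last by move=> x _; apply: F0.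
  by move=> /allP H x; apply/eqP; apply: (implyP (H x _)); rewrite ?mem_index_enum.
have n0 (z : C) : 0 <= `|z| ^+ 2 by rewrite exprn_ge0.
have Y0 : \sum_b \sum_k \sum_k' `|Y b k k'| ^+ 2 = 0 /\
   \sum_k \sum_k' \sum_a \sum_a' `|Z k k' a a'| ^+ 2 = 0.
  move/eqP: key; rewrite paddr_eq0 ?mulrn_eq0 /=.
  - by move=> /andP[/eqP -> /eqP ->].
  - by do 3 (apply: sumr_ge0 => ? _).
  - by rewrite mulrn_wge0 //; do 4 (apply: sumr_ge0 => ? _).
case: Y0 => Y0 Z0; exists N; split=> //.
  move=> b; split; first exact: (psd_push (fun p : K * A => (b, (p.1, p.2))) pN).
  move=> k k'; apply/eqP; rewrite -subr_eq0 -/(Y b k k') -normr_eq0 -sqrf_eq0; apply/eqP.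
  move: k'; apply: (sge) => //; move: k; apply: (sge) => [k|]; first exact: sumr_ge0.
  by move: b; apply: (sge) => [b|//]; do 2 (apply: sumr_ge0 => ? _).
move=> k k' a a'; apply/eqP; rewrite -subr_eq0 -/(Z k k' a a') -normr_eq0 -sqrf_eq0; apply/eqP.
move: a'; apply: (sge) => //; move: a; apply: (sge) => [a|]; first exact: sumr_ge0.
move: k'; apply: (sge) => [k'|]; first by do 2 (apply: sumr_ge0 => ? _).
by move: k; apply: (sge) => [k|//]; do 3 (apply: sumr_ge0 => ? _).
Qed.

End Wittstock.

(** * The operator space norms *)

Section OperatorSpaces.
Variable R : realType.
Local Notation C := (R[i]).
Local Notation "x %:C" := (real_complex R x).
Implicit Types I J K A P Q X : finType.

(** The empty set has supremum 0, whence the condition on [b]. *)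
Lemma sup_bounded (S : classical_sets.set R) b : 0 <= b -> (forall x, S x -> x <= b) -> sup S <= b.
Proof.
move=> b0 h; have [->|/set0P ne] := eqVneq S classical_sets.set0; first by rewrite sup0.
exact: ge_sup.
Qed.

Lemma sup_member (S : classical_sets.set R) b x : (forall x, S x -> x <= b) -> S x -> x <= sup S.
Proof. by move=> h; apply: ub_le_sup; exists b. Qed.

Lemma vn2E I (v : I -> C) : (vn2 R I v)%:C = n2 v.
Proof.
rewrite rmorph_sum; apply: eq_bigr => i _; case: (v i) => a b /=.
by apply/eqP; rewrite eq_complex /=; apply/andP; split; apply/eqP; ring.
Qed.

Lemma cabsE (z : C) : (cabs R z)%:C = `|z|.
Proof. by case: z. Qed.

Let mulv I (M : I -> I -> C) v : I -> C := fun i => \sum_j M i j * v j.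

Lemma opnorm_bound I (M : I -> I -> C) (c : R) v :
  0 < c -> ctr (fun i j => c%:C * M i j) -> vn2 R I v <= 1 ->
  Num.sqrt (vn2 R I (mulv M v)) <= c^-1.
Proof.
move=> c0 h v1.
have := ctr_n2 v h.
have -> : n2 (fun i => \sum_j c%:C * M i j * v j) = (c ^+ 2 * vn2 R I (mulv M v))%:C.
  rewrite rmorphM /= vn2E.
  have -> : (c ^+ 2)%:C = `|c%:C| ^+ 2 by rewrite ger0_norm ?ler0c ?ltW // rmorphXn.
  rewrite -n2Z; apply: eq_n2 => i; rewrite big_distrr; apply: eq_bigr => j _ /=; ring.
rewrite -vn2E lecR => le.
rewrite -[c^-1]mul1r ler_pdivlMr // -[X in _ * X](ger0_norm (ltW c0)) -sqrtr_sqr mulrC.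
rewrite -sqrtrM; last by rewrite exprn_ge0 // ltW.
rewrite -[X in _ <= X](@sqrtr1 R) ler_sqrt //.
exact: le_trans le v1.
Qed.

Lemma opnorm_le I (M : I -> I -> C) (c : R) :
  0 < c -> ctr (fun i j => c%:C * M i j) -> opnorm R I M <= c^-1.
Proof.
move=> c0 h; apply: sup_bounded; first by rewrite invr_ge0 ltW.
by move=> x [v [v1 ->]]; apply: opnorm_bound.
Qed.

Lemma ctr_rscale I (M : I -> I -> C) : exists2 c : R, 0 < c & ctr (fun i j => c%:C * M i j).
Proof.
pose s := \sum_p `|M p.1 p.2| + 1.
have s0 : 0 < s by rewrite ltr_wpDl // sumr_ge0.
have hs : \sum_p `|M p.1 p.2| <= s by rewrite lerDl ler01.
have [x ex] := complex_realP _ (gtr0_real s0).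
have x0 : 0 < x by rewrite ex ltcR in s0.
exists x^-1; first by rewrite invr_gt0.
by apply: eq_ctr (ctr_scale hs s0) => i j; rewrite ex fmorphV.
Qed.

Lemma opnorm_ge I (M : I -> I -> C) v :
  vn2 R I v <= 1 -> Num.sqrt (vn2 R I (mulv M v)) <= opnorm R I M.
Proof.
move=> v1; have [c c0 h] := ctr_rscale M.
apply: (@sup_member _ c^-1); last by exists v.
by move=> x [w [w1 ->]]; apply: opnorm_bound.
Qed.

Lemma opnorm1P I (M : I -> I -> C) : opnorm R I M <= 1 <-> ctr M.
Proof.
split=> h; last first.
  rewrite -[1]invr1; apply: opnorm_le => //.
  by apply: eq_ctr h => i j; rewrite rmorph1 mul1r.
apply: ctr_sphere => v w v1 w1.
have w1' : vn2 R I w <= 1 by rewrite -lecR vn2E w1 rmorph1.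
have := le_trans (opnorm_ge M w1') h.
rewrite -[X in _ <= X]sqrtr1 ler_sqrt // -lecR vn2E rmorph1 => le.
have -> : qf M v w = qf (fun i j => (i == j)%:R) v (mulv M w).
  apply: eq_bigr => i _; transitivity ((v i)^* * mulv M w i).
    by rewrite big_distrr; apply: eq_bigr => j _ /=; rewrite mulrA.
  rewrite -(sum_delta i (mulv M w)) big_distrr; apply: eq_bigr => j _ /=; rewrite mulrA //.
have /(le_trans (ctr_delta v _)) : n2 v + n2 (mulv M w) <= 1 *+ 2.
  by rewrite v1 mulr2n lerD2l.
by rewrite lerMn2r.
Qed.

(** * Unit balls of the completely bounded, dual and minimal tensor norms *)

Definition lmap P K (L : P -> P -> K -> K -> C) I (U : I -> I -> K -> K -> C)
  (p q : I * P) : C := \sum_k \sum_k' L p.2 q.2 k k' * U p.1 q.1 k k'.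

(** The coordinate functionals are completely contractive. This bounds the set behind [cbnorm]
    independently of the level [I], so that [cbnormP] can be used in both directions. *)
Definition slices K (nE : mnorms R K) := forall I (U : I -> I -> K -> K -> C),
  nE I U <= 1 -> forall k k', ctr (fun i j => U i j k k').

Lemma ctr_lmap P K (L : P -> P -> K -> K -> C) : exists2 c : R, 0 < c &
  forall I (U : I -> I -> K -> K -> C), (forall k k', ctr (fun i j => U i j k k')) ->
  ctr (fun p q => c%:C * lmap L U p q).
Proof.
pose T : finType := ((P * P) * (K * K))%type.
pose l (t : T) := L t.1.1 t.1.2 t.2.1 t.2.2.
pose s := \sum_t `|l t| + 1.
have s0 : 0 < s by rewrite ltr_wpDl // sumr_ge0.
have [x ex] := complex_realP _ (gtr0_real s0).
have x0 : 0 < x by rewrite ex ltcR in s0.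
exists x^-1; first by rewrite invr_gt0.
have sx : (x^-1)%:C = s^-1 by rewrite ex fmorphV.
move=> I U h.
have H := @ctr_comb R (I * P)%type T (index_enum _) (fun t => s^-1 * l t)
  (fun t p q => (t.1.1 == p.2)%:R * (t.1.2 == q.2)%:R * U p.1 q.1 t.2.1 t.2.2)
  (fun t => ctr_emb _ _ (h _ _)).
apply: eq_ctr (H _); last first.
  have -> : \sum_t `|s^-1 * l t| = s^-1 * \sum_t `|l t|.
    by rewrite big_distrr; apply: eq_bigr => t _; rewrite normrM ger0_norm // invr_ge0 ltW.
  rewrite mulrC ler_pdivrMr // mul1r.
  by rewrite lerDl ler01.
move=> [i p] [j q] /=; rewrite /lmap sx sum_pair exchange_big big_distrr sum_pair; apply: eq_bigr => k _ /=.
rewrite big_distrr; apply: eq_bigr => k' _ /=.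
rewrite sum_pair -(sum_delta p (fun p => s^-1 * (L p q k k' * U i j k k'))); apply: eq_bigr => p' _ /=.
rewrite -(sum_delta q (fun q => s^-1 * (L p' q k k' * U i j k k'))) big_distrr; apply: eq_bigr => q' _ /=.
by rewrite [p == p']eq_sym [q == q']eq_sym /l /=; ring.
Qed.

Lemma cbnormP K (nE : mnorms R K) P (L : P -> P -> K -> K -> C) : slices nE ->
  cbnorm R K nE P L <= 1 <->
  forall I (U : I -> I -> K -> K -> C), nE I U <= 1 -> ctr (lmap L U).
Proof.
move=> hs; split=> [h I U hU|h]; last first.
  by apply: sup_bounded => // x [I [U [hU ->]]]; apply/opnorm1P; apply: h.
have [c c0 hc] := ctr_lmap L.
apply/opnorm1P; apply: le_trans h.
apply: (@sup_member _ c^-1); last by exists I, U.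
by move=> x [I' [U' [/hs hU' ->]]]; apply: opnorm_le => //; apply: hc.
Qed.

Lemma mn_matP K I (U : I -> I -> K -> K -> C) :
  mn_mat R K I U <= 1 <-> ctr (fun p q : I * K => U p.1 q.1 p.2 q.2).
Proof. exact: opnorm1P. Qed.

Lemma ctr_slice I K (M : I * K -> I * K -> C) k k' :
  ctr M -> ctr (fun i j => M (i, k) (j, k')).
Proof. by apply: (@ctr_inj _ _ _ (fun i => (i, k)) (fun j => (j, k'))) => i j []. Qed.

Lemma mn_mat_slices K : slices (mn_mat R K).
Proof. by move=> I U /mn_matP h k k'; apply: ctr_slice h. Qed.

Lemma S1P A I (T : I -> I -> A -> A -> C) : S1 R A I T <= 1 <->
  forall J (U : J -> J -> A -> A -> C), ctr (fun p q : J * A => U p.1 q.1 p.2 q.2) ->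
  ctr (lmap (fun i j k k' => T i j k' k) U).
Proof.
apply: (iff_trans (cbnormP _ (@mn_mat_slices A))); split=> h J U hU; apply: h.
  exact/mn_matP.
by move/mn_matP: hU.
Qed.

Lemma S1_slices A : slices (S1 R A).
Proof.
move=> I T /S1P h k k'.
have u : ctr (fun p q : unit * A => (k' == p.2)%:R * (k == q.2)%:R : C).
  apply: eq_ctr (@ctr_inj R (unit * A)%type A snd snd _ _ _ (ctr_unit k' k)) => //;
  by move=> [[] a] [[] b] /= ->.
have := h _ (fun _ _ a b => (k' == a)%:R * (k == b)%:R) u.
move/(@ctr_inj _ I _ (fun i => (tt, i)) (fun i => (tt, i))) => H.
apply: eq_ctr (H _ _) => [i j|i j [] //|i j [] //].
by rewrite /lmap /= sum_delta2.
Qed.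

(** One direction applies [L] to the element of M_A(S_1^A) that represents the identity of M_A; the
    other is the definition of the dual norm, with the coefficients of [L] as the test element. *)
Lemma cbS1P A Q (L : Q -> Q -> A -> A -> C) : cbnorm R A (S1 R A) Q L <= 1 <->
  ctr (fun p q : Q * A => L p.1 q.1 q.2 p.2).
Proof.
apply: (iff_trans (cbnormP _ (@S1_slices A))); split=> [h|hW I T /S1P hT].
  have hT : S1 R A A (fun i j a a' => (i == a')%:R * (j == a)%:R) <= 1.
    apply/S1P => J U hU; apply: eq_ctr hU => -[j a] [j' a']; rewrite /lmap /=.
    by rewrite -(sum_delta2 (U j j') a a'); apply: eq_bigr => k _; apply: eq_bigr => k' _; rewrite mulrC.
  have := h _ _ hT => /(@ctr_inj _ _ _ (fun p : Q * A => (p.2, p.1)) (fun p => (p.2, p.1))) H.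
  apply: eq_ctr (H _ _) => [[q a] [q' a']|[a b] [c d] [-> ->] //|[a b] [c d] [-> ->] //].
  rewrite /lmap /= -(sum_delta2 (fun a' a => L q q' a' a) a' a); apply: eq_bigr => k _.
  by apply: eq_bigr => k' _; rewrite [(a == _)%:R * _]mulrC.
have := hT _ (fun q q' a a' => L q q' a' a) hW.
move=> /(@ctr_inj _ (I * Q)%type _ (fun p => (p.2, p.1)) (fun p => (p.2, p.1))) H.
apply: eq_ctr (H _ _) => [[i q] [j q']|[a b] [c d] [-> ->] //|[a b] [c d] [-> ->] //].
rewrite /lmap /= exchange_big; apply: eq_bigr => k _; apply: eq_bigr => k' _; exact: mulrC.
Qed.

(* Coefficients of the map [M_A -> M_I (x) M_X] attached to an element of
   [M_I(M_X (x) S_1^A)], and to a map [S_1^X(M_A) -> M_P]: the transpositions come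
   from the trace pairings. *)
Definition elt_coef X A I (u : I -> I -> X * A -> X * A -> C)
  (p q : I * X) (a a' : A) : C := u p.1 q.1 (p.2, a') (q.2, a).
Definition map_coef X A P (L : P -> P -> X * A -> X * A -> C)
  (p q : P * X) (a a' : A) : C := L p.1 q.1 (q.2, a) (p.2, a').

Let minelt X A I (u : I -> I -> X * A -> X * A -> C) P Q
   (L1 : P -> P -> X -> X -> C) (L2 : Q -> Q -> A -> A -> C) (p q : I * (P * Q)) : C :=
  \sum_k1 \sum_k1' \sum_k2 \sum_k2'
    L1 p.2.1 q.2.1 k1 k1' * L2 p.2.2 q.2.2 k2 k2' * u p.1 q.1 (k1, k2) (k1', k2').

(** The two maps are applied one after the other: [L2] first, which evaluates [elt_coef u] at a
    matrix over Q x A, then [L1] as a complete contraction on M_X. The scalar [c] lets the lemma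
    also bound the supremum. *)
Lemma minelt_ctr X A I (u : I -> I -> X * A -> X * A -> C) P Q L1 L2 (c : C) :
  cbnorm R X (mn_mat R X) P L1 <= 1 ->
  ctr (fun p q => c * amp (elt_coef u) (fun p q : Q * A => L2 p.1 q.1 q.2 p.2) p q) ->
  ctr (fun p q => c * minelt u L1 L2 p q).
Proof.
move=> /(cbnormP _ (@mn_mat_slices X)) h hV.
pose V (s t : I * Q) (x x' : X) : C :=
  c * amp (elt_coef u) (fun p q : Q * A => L2 p.1 q.1 q.2 p.2) ((s.1, x), s.2) ((t.1, x'), t.2).
have hV' : mn_mat R X _ V <= 1.
  apply/mn_matP.
  apply: (@ctr_inj R ((I * Q) * X)%type _ (fun p => ((p.1.1, p.2), p.1.2)) (fun p => ((p.1.1, p.2), p.1.2)) _ _ _ hV);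
  by move=> [[? ?] ?] [[? ?] ?] [-> -> ->].
have := h _ _ hV'.
move=> /(@ctr_inj _ (I * (P * Q))%type _ (fun p => ((p.1, p.2.2), p.2.1)) (fun p => ((p.1, p.2.2), p.2.1))) H.
apply: eq_ctr (H _ _) => [[i [p q]] [j [p' q']]|[? [? ?]] [? [? ?]] [-> -> ->] //|[? [? ?]] [? [? ?]] [-> -> ->] //].
rewrite /lmap /minelt /= big_distrr; apply: eq_bigr => x _ /=.
rewrite big_distrr; apply: eq_bigr => x' _ /=.
rewrite /V /amp exchange_big big_distrr big_distrr big_distrr; apply: eq_bigr => a _ /=.
rewrite big_distrr big_distrr big_distrr; apply: eq_bigr => a' _ /=.
by rewrite /elt_coef /=; ring.
Qed.

(** Among complete contractions on M_X the identity is the extreme case, and those on S_1^A are the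
    contractions [W] by [cbS1P]. *)
Lemma minP X A I (u : I -> I -> X * A -> X * A -> C) :
  mintensor R X A (mn_mat R X) (S1 R A) I u <= 1 <-> ccmap (elt_coef u).
Proof.
split=> [h Q W hW|h]; last first.
  apply: sup_bounded => // x [P [Q [L1 [L2 [h1 [/cbS1P h2 ->]]]]]]; apply/opnorm1P.
  have := @minelt_ctr X A I u P Q L1 L2 1 h1.
  move=> H; apply: eq_ctr (H _) => [p q|]; first by rewrite mul1r.
  by apply: eq_ctr (h _ _ h2) => p q; rewrite mul1r.
have [c c0 hc] := ctr_lmap (elt_coef u).
have hc' Q' (W' : Q' * A -> Q' * A -> C) : ctr W' -> ctr (fun p q => c%:C * amp (elt_coef u) W' p q).
  move=> hW'; have := hc _ (fun q q' a a' => W' (q, a) (q', a')) (fun k k' => ctr_slice k k' hW').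
  move=> /(@ctr_inj _ _ _ (fun p : (I * X) * Q' => (p.2, p.1)) (fun p => (p.2, p.1))) H.
  by apply: eq_ctr (H _ _) => [//|[? ?] [? ?] [-> ->] //|[? ?] [? ?] [-> ->] //].
pose L1 (p p' x x' : X) : C := (p == x)%:R * (p' == x')%:R.
pose L2 (q q' : Q) (a a' : A) : C := W (q, a') (q', a).
have h1 : cbnorm R X (mn_mat R X) X L1 <= 1.
  apply/cbnormP; first exact: mn_mat_slices.
  move=> J U /mn_matP hU; apply: eq_ctr hU => -[j a] [j' a']; rewrite /lmap /=.
  by rewrite -(sum_delta2 (U j j') a a'); apply: eq_bigr => k _; apply: eq_bigr => k' _; rewrite mulrC.
have h2 : cbnorm R A (S1 R A) Q L2 <= 1.
  by apply/cbS1P; apply: eq_ctr hW => -[? ?] [? ?].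
have : ctr (minelt u L1 L2).
  apply/opnorm1P; apply: le_trans h; apply: (@sup_member _ c^-1); last first.
    by exists X, Q, L1, L2.
  move=> x [P' [Q' [L1' [L2' [h1' [/cbS1P h2' ->]]]]]].
  by apply: opnorm_le => //; apply: minelt_ctr => //; apply: hc'.
move=> /(@ctr_inj _ ((I * X) * Q)%type _ (fun p => (p.1.1, (p.1.2, p.2))) (fun p => (p.1.1, (p.1.2, p.2)))) H.
apply: eq_ctr (H _ _) => [[[i x] q] [[j x'] q']|[[? ?] ?] [[? ?] ?] [-> -> ->] //|[[? ?] ?] [[? ?] ?] [-> -> ->] //].
rewrite /minelt /amp /= -(sum_delta2 (fun x x' => \sum_a \sum_a' elt_coef u (i, x) (j, x') a a' * W (q, a) (q', a')) x x').
apply: eq_bigr => k _; apply: eq_bigr => k' _.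
rewrite exchange_big big_distrl; apply: eq_bigr => a _ /=; rewrite big_distrl; apply: eq_bigr => a' _ /=.
by rewrite /L1 /L2 /elt_coef /=; ring.
Qed.

Lemma min_slices X A : slices (mintensor R X A (mn_mat R X) (S1 R A)).
Proof.
move=> I u /minP h [x a'] [x' a].
apply: (@ctr_inj _ _ _ (fun i => (i, x)) (fun i => (i, x')) _ _ _ (ccmap_slice a a' h));
by move=> ? ? [].
Qed.

Lemma S1MP X A I (T : I -> I -> X * A -> X * A -> C) : S1M R X A I T <= 1 <->
  forall J (u : J -> J -> X * A -> X * A -> C), ccmap (elt_coef u) ->
  ctr (lmap (fun i j k k' => T i j k' k) u).
Proof.
apply: (iff_trans (cbnormP _ (@min_slices X A))); split=> h J U hU; apply: h.
  exact/minP.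
by move/minP: hU.
Qed.

Lemma S1M_slices X A : slices (S1M R X A).
Proof.
move=> I T /S1MP h k k'.
have u : ccmap (elt_coef (fun (_ _ : unit) l l' => (k' == l)%:R * (k == l')%:R : C)).
  move=> Q W hW.
  have := ctr_emb k'.1 k.1 (ctr_slice k.2 k'.2 hW).
  move=> /(@ctr_inj _ ((unit * X) * Q)%type _ (fun p => (p.2, p.1.2)) (fun p => (p.2, p.1.2))) H.
  apply: eq_ctr (H _ _) => [[[[] x] q] [[[] x'] q']|[[[] ?] ?] [[[] ?] ?] [-> ->] //|[[[] ?] ?] [[[] ?] ?] [-> ->] //].
  rewrite /amp /elt_coef /=.
  rewrite -(sum_delta2 (fun a a' => (k'.1 == x)%:R * (k.1 == x')%:R * W (q, a) (q', a')) k.2 k'.2).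
  apply: eq_bigr => a _; apply: eq_bigr => a' _.
  have eqE (l : X * A) y b : (l == (y, b))%:R = (l.1 == y)%:R * (l.2 == b)%:R :> C.
    by case: l => ? ?; rewrite xpair_eqE -mulnb natrM.
  by rewrite !eqE; ring.
have := h _ _ u.
move/(@ctr_inj _ I _ (fun i => (tt, i)) (fun i => (tt, i))) => H.
apply: eq_ctr (H _ _) => [i j|i j [] //|i j [] //].
by rewrite /lmap /= sum_delta2.
Qed.

(** From left to right, [W] combined with the matrix units that represent the identity of M_X is an
    element [T] of the unit ball over S_1^X(M_A). From right to left, [L] with its pairs transposed
    is itself in the unit ball against which the dual norm of [T] is tested. *)
Lemma cbS1MP X A P (L : P -> P -> X * A -> X * A -> C) :
  cbnorm R (X * A)%type (S1M R X A) P L <= 1 <-> ccmap (map_coef L).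
Proof.
apply: (iff_trans (cbnormP _ (@S1M_slices X A))); split=> [h Q W hW|h I T /S1MP hT].
  pose T (i j : X * Q) (k k' : X * A) : C := W (i.2, k.2) (j.2, k'.2) * ((j.1 == k.1)%:R * (i.1 == k'.1)%:R).
  have hT : S1M R X A _ T <= 1.
    apply/S1MP => J u hu; have := hu _ _ hW.
    move=> /(@ctr_inj _ (J * (X * Q))%type _ (fun p => ((p.1, p.2.1), p.2.2)) (fun p => ((p.1, p.2.1), p.2.2))) H.
    apply: eq_ctr (H _ _) => [[i [x q]] [j [x' q']]|[? [? ?]] [? [? ?]] [-> -> ->] //|[? [? ?]] [? [? ?]] [-> -> ->] //].
    rewrite /amp /lmap /T /elt_coef /= exchange_big.
    transitivity (\sum_y \sum_y' (\sum_a' \sum_a u i j (y, a') (y', a) * W (q, a) (q', a')) * ((x == y)%:R * (x' == y')%:R)).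
      by rewrite sum_delta2.
    rewrite sum_pair; apply: eq_bigr => y _ /=.
    under [RHS]eq_bigr => a _ do rewrite sum_pair.
    rewrite [RHS]exchange_big; apply: eq_bigr => y' _ /=.
    rewrite big_distrl; apply: eq_bigr => a _ /=; rewrite big_distrl; apply: eq_bigr => a' _ /=; ring.
  have := h _ _ hT.
  move=> /(@ctr_inj _ ((P * X) * Q)%type _ (fun p => ((p.1.2, p.2), p.1.1)) (fun p => ((p.1.2, p.2), p.1.1))) H.
  apply: eq_ctr (H _ _) => [[[p x] q] [[p' x'] q']|[[? ?] ?] [[? ?] ?] [-> -> ->] //|[[? ?] ?] [[? ?] ?] [-> -> ->] //].
  rewrite /lmap /amp /map_coef /T /=.
  transitivity (\sum_y \sum_y' (\sum_a \sum_a' L p p' (y, a) (y', a') * W (q, a) (q', a')) * ((x' == y)%:R * (x == y')%:R)); last first.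
    by rewrite sum_delta2.
  rewrite sum_pair; apply: eq_bigr => y _ /=.
  under [LHS]eq_bigr => a _ do rewrite sum_pair.
  rewrite [LHS]exchange_big; apply: eq_bigr => y' _ /=.
  rewrite big_distrl; apply: eq_bigr => a _ /=; rewrite big_distrl; apply: eq_bigr => a' _ /=; ring.
have := hT P (fun p p' k k' => L p p' k' k) h.
move=> /(@ctr_inj _ (I * P)%type _ (fun p => (p.2, p.1)) (fun p => (p.2, p.1))) H.
apply: eq_ctr (H _ _) => [[i q] [j q']|[a b] [c d] [-> ->] //|[a b] [c d] [-> ->] //].
rewrite /lmap /= exchange_big; apply: eq_bigr => k _; apply: eq_bigr => k' _; exact: mulrC.
Qed.

(** * Functionals: the norm equals the completely bounded norm *)

Lemma ccmap_dualnorm X A (f : X * A -> X * A -> C) :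
  ccmap (map_coef (fun _ _ : unit => f)) -> dualnorm R (X * A)%type (S1M R X A) f <= 1.
Proof.
move=> /cbS1MP /(cbnormP _ (@S1M_slices X A)) h.
apply: sup_bounded => // x [e [he ->]].
rewrite -lecR cabsE rmorph1.
have := ctr_entry (tt, tt) (tt, tt) (h _ _ he); exact.
Qed.

(** A form value of the amplified functional at unit vectors [v], [w] is [f] at one element [e], the
    contraction of [W] with [v] and [w]. *)
Lemma dualnorm_ccmap X A (f : X * A -> X * A -> C) :
  dualnorm R (X * A)%type (S1M R X A) f <= 1 -> ccmap (map_coef (fun _ _ : unit => f)).
Proof.
move=> h Q W hW; apply: ctr_sphere => v w v1 w1.
pose e (k k' : X * A) : C := \sum_q \sum_q'
  (v ((tt, k'.1), q))^* * W (q, k.2) (q', k'.2) * w ((tt, k.1), q').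
have he : norm1 R (X * A)%type (S1M R X A) e <= 1.
  (* The form of [u] against [e] at [a], [b] is the form of the image of [W] at the product vectors
     of [a] with [v] and of [b] with [w], which are as long as [a] and [b]. *)
  apply/S1MP => J u hu a b.
  pose va (p : (J * X) * Q) := a (p.1.1, tt) * v ((tt, p.1.2), p.2).
  pose wb (p : (J * X) * Q) := b (p.1.1, tt) * w ((tt, p.1.2), p.2).
  have n2v (c : J * unit -> C) (z : unit * X * Q -> C) : n2 z = 1 ->
     n2 (fun p : (J * X) * Q => c (p.1.1, tt) * z ((tt, p.1.2), p.2)) = n2 c.
    move=> z1; rewrite /n2 !sum_pair; apply: eq_bigr => j _.
    rewrite (big_pred1 tt) => [|[] //]; rewrite -[RHS]mulr1 -z1 /n2 sum_pair sum_pair (big_pred1 tt) => [|[] //].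
    rewrite big_distrr; apply: eq_bigr => x _ /=; rewrite big_distrr; apply: eq_bigr => q _ /=.
    by rewrite rmorphM /=; ring.
  rewrite -(n2v a v v1) -(n2v b w w1); apply: le_trans (hu _ _ hW va wb).
  rewrite le_eqVlt; apply/orP; left; apply/eqP; congr (`|_| *+ 2).
  rewrite /qf !sum_pair; apply: eq_bigr => i _; rewrite (big_pred1 tt) => [|[] //].
  under [RHS]eq_bigr => x _ do under eq_bigr => q _ do rewrite !sum_pair.
  under [RHS]eq_bigr => x _ do rewrite exchange_big /=.
  rewrite [RHS]exchange_big sum_pair; apply: eq_bigr => j _ /=; rewrite (big_pred1 tt) => [|[] //].
  transitivity (\sum_x \sum_x' \sum_a1 \sum_a1' \sum_q \sum_q'
    ((va (i, x, q))^* * (elt_coef u (i, x) (j, x') a1 a1' * W (q, a1) (q', a1')) * wb (j, x', q'))).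
    rewrite /lmap big_distrr big_distrl sum_pair; apply: eq_bigr => x _ /=.
    under eq_bigr => a1 _ do rewrite sum_pair big_distrr big_distrl /=.
    rewrite exchange_big; apply: eq_bigr => x' _ /=.
    under eq_bigr => a1 _ do rewrite big_distrr big_distrl /=.
    rewrite exchange_big; apply: eq_bigr => a1 _ /=; apply: eq_bigr => a1' _.
    rewrite /e big_distrl big_distrr big_distrl; apply: eq_bigr => q _ /=.
    rewrite big_distrl big_distrr big_distrl; apply: eq_bigr => q' _ /=.
    by rewrite /va /wb /elt_coef rmorphM /=; ring.
  apply: eq_bigr => x _; rewrite [RHS]exchange_big; apply: eq_bigr => x' _ /=.
  under [LHS]eq_bigr => a1 _ do rewrite exchange_big /=.
  rewrite [LHS]exchange_big; apply: eq_bigr => q _ /=.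
  under [LHS]eq_bigr => a1 _ do rewrite exchange_big /=.
  rewrite [LHS]exchange_big; apply: eq_bigr => q' _ /=.
  rewrite /amp big_distrr big_distrl; apply: eq_bigr => a1 _ /=.
  by rewrite big_distrr big_distrl.
have : cabs R (\sum_k \sum_k' f k k' * e k k') <= 1.
  (* The entries of an element of norm at most 1 are at most 1 in modulus, so the moduli of [f] sum
     to an upper bound. *)
  apply: le_trans h; apply: (@sup_member _ (complex.Re (\sum_k \sum_k' `|f k k'|))); last by exists e.
  move=> x [e' [he' ->]].
  have le : `|\sum_k \sum_k' f k k' * e' k k'| <= \sum_k \sum_k' `|f k k'|.
    apply: le_trans (ler_norm_sum _ _ _) _; apply: ler_sum => k _.
    apply: le_trans (ler_norm_sum _ _ _) _; apply: ler_sum => k' _.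
    rewrite normrM ler_piMr //.
    exact: (ctr_entry tt tt (S1M_slices he' k k')).
  move: le; rewrite -cabsE lecE => /andP[_]; exact.
rewrite -lecR cabsE rmorph1; congr (`|_| <= _).
rewrite /qf !sum_pair (big_pred1 tt) => [|[] //].
under [RHS]eq_bigr => x _ do under eq_bigr => q _ do rewrite !sum_pair (big_pred1 tt) //.
transitivity (\sum_x \sum_x' \sum_a \sum_a' \sum_q \sum_q'
  (v (tt, x, q))^* * (f (x', a) (x, a') * W (q, a) (q', a')) * w (tt, x', q')).
  rewrite [RHS]exchange_big; apply: eq_bigr => x' _ /=.
  under eq_bigr => a _ do rewrite sum_pair.
  rewrite [LHS]exchange_big; apply: eq_bigr => x _ /=; apply: eq_bigr => a _; apply: eq_bigr => a' _.
  rewrite /e big_distrr; apply: eq_bigr => q _ /=; rewrite big_distrr; apply: eq_bigr => q' _ /=; ring.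
apply: eq_bigr => x _; rewrite [RHS]exchange_big; apply: eq_bigr => x' _ /=.
under [LHS]eq_bigr => a1 _ do rewrite exchange_big /=.
rewrite [LHS]exchange_big; apply: eq_bigr => q _ /=.
under [LHS]eq_bigr => a1 _ do rewrite exchange_big /=.
rewrite [LHS]exchange_big; apply: eq_bigr => q' _ /=.
rewrite /amp big_distrr big_distrl; apply: eq_bigr => a1 _ /=.
by rewrite big_distrr big_distrl.
Qed.

End OperatorSpaces.

(** * Values of the game *)

Section Game.
Local Notation psd M := (psd _ _ M).
Variable R : realType.
Local Notation C := (R[i]).
Local Notation "x %:C" := (real_complex R x).

Lemma sup_ge0 (S : classical_sets.set R) : (forall x, S x -> 0 <= x) -> 0 <= sup S.
Proof.
move=> h; have [hs|hs] := pselect (has_sup S); last by rewrite sup_out.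
have [[x Sx] ub] := hs.
by apply: le_trans (h _ Sx) _; apply: ub_le_sup.
Qed.

Lemma opnorm_ge0 (I : finType) (M : I -> I -> C) : 0 <= opnorm R I M.
Proof. by apply: sup_ge0 => x [v [_ ->]]; apply: sqrtr_ge0. Qed.

Lemma opnorm_le_form (I : finType) (M : I -> I -> C) (w : R) : 0 <= w ->
  (forall u v, n2 u = 1 -> n2 v = 1 -> `|qf M u v| <= w%:C) -> opnorm R I M <= w.
Proof.
(* [opnorm_le] needs an invertible scale; the slack [e] covers [w = 0]. *)
move=> w0 h; apply/ler_addgt0Pr => e e0.
have we : 0 < w + e by rewrite ltr_wpDl.
rewrite -[w + e]invrK; apply: opnorm_le; first by rewrite invr_gt0.
apply: ctr_sphere => u v u1 v1; rewrite qfMZ normrM fmorphV normfV.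
have we' : 0 < (w + e)%:C :> C by rewrite ltcR.
rewrite (gtr0_norm we') mulrC ler_pdivrMr // mul1r (le_trans (h _ _ u1 v1)) //.
by rewrite lecR lerDl ltW.
Qed.

Lemma form_le_opnorm (I : finType) (M : I -> I -> C) v : n2 v = 1 ->
  `|qf M v v| <= (opnorm R I M)%:C.
Proof.
move=> v1; have v1' : vn2 R I v <= 1 by rewrite -lecR vn2E v1 rmorph1.
have := opnorm_ge M v1'; set u := fun i : I => \sum_j M i j * v j; set w := opnorm _ _ _ => le.
have w0 : 0 <= w by apply: opnorm_ge0.
have -> : qf M v v = qf (fun i j => (i == j)%:R) v u.
  apply: eq_bigr => i _; transitivity ((v i)^* * u i).
    by rewrite big_distrr; apply: eq_bigr => j _ /=; rewrite mulrA.
  rewrite -(sum_delta i u) big_distrr; apply: eq_bigr => j _ /=; rewrite mulrA //.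
have nu : n2 u <= (w ^+ 2)%:C.
  rewrite -vn2E lecR -[vn2 _ _ _]sqr_sqrtr; last first.
    by rewrite -ler0c vn2E n2_ge0.
  by rewrite lerXn2r // nnegrE sqrtr_ge0.
have [w1|w1] := eqVneq w 0.
  have u0 : n2 u = 0.
    by apply: le_anti; rewrite n2_ge0 andbT (le_trans nu) // w1 expr0n rmorph0.
  rewrite /qf big1 ?normr0 ?ler0c // => i _; rewrite big1 // => j _.
  by rewrite (n2_eq0 u0) mulr0.
have wp : 0 < w by rewrite lt_neqAle eq_sym w1.
have wp' : 0 < w%:C :> C by rewrite ltcR.
have := ctr_delta v (fun i => (w%:C)^-1 * u i).
rewrite qfZr n2Z v1 normrM normfV (gtr0_norm wp').
have le2 : w%:C^-1 ^+ 2 * n2 u <= 1.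
  by rewrite exprVn mulrC ler_pdivrMr ?exprn_gt0 // mul1r -rmorphXn.
move=> /le_trans/(_ _)H; have := H (1 *+ 2); rewrite mulr2n lerD2l => /(_ le2).
by rewrite -[1 + 1]mulr2n lerMn2r /= mulrC ler_pdivrMr // mul1r.
Qed.

(** Cauchy-Schwarz for the off-diagonal block: positivity at the vectors [(u, c v)] for all phases
    [c]. *)
Lemma psd_bool_form (I : finType) (H : bool * I -> bool * I -> C) u v : psd H ->
  `|qf (fun i j => H (true, i) (false, j)) u v| *+ 2 <=
  qf (fun i j => H (true, i) (true, j)) u u + qf (fun i j => H (false, i) (false, j)) v v.
Proof.
move=> pH; apply: phase_le => c c1.
have := pH (fun p => if p.1 then u p.2 else c * v p.2); congr (0 <= _).
set w := fun p => _.
transitivity (qf (fun i j => H (true, i) (true, j)) u u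
  + qf (fun i j => H (true, i) (false, j)) u (fun i => c * v i)
  + (qf (fun i j => H (false, i) (true, j)) (fun i => c * v i) u
  + qf (fun i j => H (false, i) (false, j)) (fun i => c * v i) (fun i => c * v i))).
  rewrite sum_pair sum_bool; congr (_ + _); rewrite /qf -big_split; apply: eq_bigr => i _ /=;
  by rewrite sum_pair sum_bool.
rewrite !qfZr !qfZl.
have -> : qf (fun i j => H (false, i) (true, j)) v u = (qf (fun i j => H (true, i) (false, j)) u v)^*.
  rewrite {2}/qf exchange_big rmorph_sum; apply: eq_bigr => i _; rewrite rmorph_sum.
  by apply: eq_bigr => j _; rewrite !rmorphM /= conjCK (psd_herm _ _ pH); ring.
have cc : c * c^* = 1 by rewrite -normCK c1 expr1n.
by rewrite mulrA cc rmorphM mul1r; ring.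
Qed.

Implicit Types H : finType.
Variables (X Y A B Rr Kk : finType) (xi : X * Y * Rr -> C).
Variables (lam : Kk -> R) (gma : Kk -> A * B * Rr -> C).
Hypothesis lam0 : forall k, 0 <= lam k.
Let P := mkP R Kk (A * B * Rr)%type lam gma.
Let G := GG R X Y A B Rr xi P.
Let XAYB : finType := ((X * A) * (Y * B))%type.

(** Contraction of the conjugate of [xi] with [gma k] over the register [Rr]; these vectors exhibit
    [Gt] as a nonnegative combination of rank one matrices. *)
Let tau k (j : XAYB) : C := \sum_r (xi (j.1.1, j.2.1, r))^* * gma k (j.1.2, j.2.2, r).

(* [Gt] is the positive element [xi xi^* (x) P] before the transpositions: see [GGE]. *)
Let Gt (j j' : XAYB) : C := \sum_k (lam k)%:C * ((tau k j)^* * tau k j').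

Definition game_mx H H' (c : H * X -> H * X -> A -> A -> C)
   (d : H' * Y -> H' * Y -> B -> B -> C) (p q : H * H') : C :=
  \sum_j \sum_j' c (p.1, j.1.1) (q.1, j'.1.1) j.1.2 j'.1.2 *
    d (p.2, j.2.1) (q.2, j'.2.1) j.2.2 j'.2.2 * Gt j j'.

Lemma GtE x x' y y' a a' b b' :
  Gt ((x, a), (y, b)) ((x', a'), (y', b')) =
  \sum_r \sum_r' xi (x, y, r) * (xi (x', y', r'))^* * P (a', b', r') (a, b, r).
Proof.
transitivity (\sum_k \sum_r \sum_r' (lam k)%:C * (xi (x, y, r) * (gma k (a, b, r))^* *
    ((xi (x', y', r'))^* * gma k (a', b', r')))).
  apply: eq_bigr => k _; rewrite /tau rmorph_sum big_distrlr big_distrr; apply: eq_bigr => r _ /=.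
  by rewrite big_distrr; apply: eq_bigr => r' _ /=; rewrite rmorphM /= conjCK.
rewrite exchange_big; apply: eq_bigr => r _; rewrite exchange_big; apply: eq_bigr => r' _ /=.
rewrite /P /mkP big_distrr; apply: eq_bigr => k _ /=.
by rewrite -[rC R (lam k)]/((lam k)%:C); ring.
Qed.

(** By hermitian symmetry, the conjugation in [G] leaves [Gt] transposed in the X and Y coordinates
    alone. The transposition in [map_coef] undoes this in [game_mxE]. *)
Lemma GGE x x' y y' a a' b b' :
  G ((x', a), (y', b)) ((x, a'), (y, b')) = Gt ((x, a), (y, b)) ((x', a'), (y', b')).
Proof.
rewrite GtE /G /GG /= exchange_big rmorph_sum; apply: eq_bigr => r _; rewrite rmorph_sum.
apply: eq_bigr => r' _ /=; rewrite !rmorphM /= conjCK [(xi _)^* * _]mulrC; congr (_ * _).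
rewrite /P /mkP rmorph_sum; apply: eq_bigr => k _; rewrite !rmorphM /= conjCK.
have -> : (rC R (lam k))^* = rC R (lam k) :> C by rewrite -[rC R (lam k)]/((lam k)%:C) conj_Creal // complex_real.
by ring.
Qed.

Lemma sum_swap (T U : finType) (f : T * U -> T * U -> C) :
  \sum_k \sum_k' f k k' = \sum_k \sum_k' f (k'.1, k.2) (k.1, k'.2).
Proof.
rewrite !sum_pair.
under eq_bigr => x _ do under eq_bigr => a _ do rewrite sum_pair.
under eq_bigr => x _ do rewrite exchange_big /=.
rewrite exchange_big; apply: eq_bigr => x' _ /=.
under [RHS]eq_bigr => a _ do rewrite sum_pair.
by rewrite [RHS]exchange_big.
Qed.

Lemma game_mxE H H' (L1 : H -> H -> X * A -> X * A -> C) (L2 : H' -> H' -> Y * B -> Y * B -> C)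
  (p q : H * H') :
  \sum_k1 \sum_k1' \sum_k2 \sum_k2' L1 p.1 q.1 k1 k1' * L2 p.2 q.2 k2 k2' * G (k1, k2) (k1', k2')
  = game_mx (map_coef L1) (map_coef L2) p q.
Proof.
rewrite sum_swap /game_mx [RHS]sum_pair; apply: eq_bigr => -[x a] _ /=.
under [RHS]eq_bigr => k2 _ do rewrite sum_pair.
rewrite [RHS]exchange_big; apply: eq_bigr => -[x' a'] _ /=.
rewrite sum_swap; apply: eq_bigr => -[y b] _; apply: eq_bigr => -[y' b'] _ /=.
by rewrite GGE.
Qed.

Lemma game_valueE (gam : corr R X Y A B) :
  game_value R X Y A B Rr gam xi P =
  \sum_(j : XAYB) \sum_(j' : XAYB) gam j.1.1 j'.1.1 j.2.1 j'.2.1 (j.1.2, j.2.2) (j'.1.2, j'.2.2) * Gt j j'.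
Proof.
have sumj (F : XAYB -> C) : \sum_j F j =
    \sum_(ab : A * B) \sum_(xy : X * Y) F ((xy.1, ab.1), (xy.2, ab.2)).
  transitivity (\sum_x \sum_a \sum_y \sum_b F ((x, a), (y, b))).
    rewrite sum_pair [LHS]sum_pair; apply: eq_bigr => x _; apply: eq_bigr => a _.
    by rewrite sum_pair.
  under [RHS]eq_bigr => ab _ do rewrite sum_pair.
  rewrite [RHS]exchange_big; apply: eq_bigr => x _ /=.
  rewrite [RHS]sum_pair; apply: eq_bigr => a _ /=; exact: exchange_big.
rewrite sumj /game_value sum_pair; apply: eq_bigr => -[a b] _ /=.
under [RHS]eq_bigr => xy _ do rewrite sumj.
rewrite [RHS]exchange_big.
under [LHS]eq_bigr => r _ do rewrite sum_pair.
rewrite [LHS]exchange_big; apply: eq_bigr => -[a' b'] _ /=.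
transitivity (\sum_r \sum_r' \sum_(xy : X * Y) \sum_(xy' : X * Y)
   gam xy.1 xy'.1 xy.2 xy'.2 (a, b) (a', b') *
   (xi (xy.1, xy.2, r) * (xi (xy'.1, xy'.2, r'))^* * P (a', b', r') (a, b, r))).
  apply: eq_bigr => r _; apply: eq_bigr => r' _.
  rewrite sum_pair big_distrl; apply: eq_bigr => x _ /=.
  under [RHS]eq_bigr => y _ do rewrite sum_pair.
  rewrite [RHS]exchange_big big_distrl; apply: eq_bigr => x' _ /=.
  rewrite big_distrl; apply: eq_bigr => y _ /=.
  by rewrite big_distrl; apply: eq_bigr => y' _ /=; ring.
under [LHS]eq_bigr => r _ do rewrite exchange_big /=.
rewrite [LHS]exchange_big; apply: eq_bigr => -[x y] _ /=.
under [LHS]eq_bigr => r _ do rewrite exchange_big /=.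
rewrite [LHS]exchange_big; apply: eq_bigr => -[x' y'] _ /=.
by rewrite GtE big_distrr; apply: eq_bigr => r _; rewrite big_distrr.
Qed.

(** [game_mx] combines, with the entries of [Gt] as coefficients, products of a slice of [c1] and a
    slice of [c2]. Such a product is a contraction: it is cut out of the image under [c1] of a
    matrix unit tensored with a slice of [c2]. *)
Lemma game_mx_bound : exists2 c : R, 0 < c &
  forall H H' (c1 : H * X -> H * X -> A -> A -> C) (c2 : H' * Y -> H' * Y -> B -> B -> C),
  ccmap c1 -> ccmap c2 -> ctr (fun p q => c%:C * game_mx c1 c2 p q).
Proof.
pose s := \sum_(t : XAYB * XAYB) `|Gt t.1 t.2| + 1.
have s0 : 0 < s by rewrite ltr_wpDl // sumr_ge0.
have [z ez] := complex_realP _ (gtr0_real s0).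
have z0 : 0 < z by rewrite ez ltcR in s0.
exists z^-1; first by rewrite invr_gt0.
move=> H H' c1 c2 h1 h2.
have sz : (z^-1)%:C = s^-1 by rewrite ez fmorphV.
pose M (t : XAYB * XAYB) (p q : H * H') : C := c1 (p.1, t.1.1.1) (q.1, t.2.1.1) t.1.1.2 t.2.1.2 *
    c2 (p.2, t.1.2.1) (q.2, t.2.2.1) t.1.2.2 t.2.2.2.
have hM t : ctr (M t).
  case: t => [[[x a] [y b]] [[x' a'] [y' b']]].
  have := h1 _ _ (ctr_emb a a' (ccmap_slice b b' h2)).
  move=> /(@ctr_inj _ (H * H')%type _ (fun p => ((p.1, x), (p.2, y))) (fun p => ((p.1, x'), (p.2, y')))) K.
  apply: eq_ctr (K _ _) => [p q|[? ?] [? ?] [-> ->] //|[? ?] [? ?] [-> ->] //].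
  rewrite /M /amp /= -(sum_delta2 (fun a a' => c1 (p.1, x) (q.1, x') a a' * c2 (p.2, y) (q.2, y') b b') a a').
  by apply: eq_bigr => k _; apply: eq_bigr => k' _; ring.
have K := @ctr_comb R _ _ (index_enum _) (fun t : XAYB * XAYB => s^-1 * Gt t.1 t.2) M hM.
apply: eq_ctr (K _) => [p q|].
  rewrite /game_mx sum_pair sz big_distrr; apply: eq_bigr => j _ /=.
  rewrite big_distrr; apply: eq_bigr => j' _ /=; rewrite /M /=; ring.
have -> : \sum_(t : XAYB * XAYB) `|s^-1 * Gt t.1 t.2| = s^-1 * \sum_(t : XAYB * XAYB) `|Gt t.1 t.2|.
  by rewrite big_distrr; apply: eq_bigr => t _; rewrite normrM ger0_norm // invr_ge0 ltW.
by rewrite mulrC ler_pdivrMr // mul1r lerDl ler01.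
Qed.

(** For each [k] the form at [v] is that of the Kronecker product of [N1] and [N2], compressed to a
    common block index, at the product of [v] with [tau k]. *)
Lemma game_mx_psd H H' (N1 : bool * ((H * X) * A) -> bool * ((H * X) * A) -> C)
   (N2 : bool * ((H' * Y) * B) -> bool * ((H' * Y) * B) -> C) : psd N1 -> psd N2 ->
  psd (fun p q : bool * (H * H') =>
    game_mx (fun k k' a a' => N1 (p.1, (k, a)) (q.1, (k', a')))
            (fun k k' b b' => N2 (p.1, (k, b)) (q.1, (k', b'))) p.2 q.2).
Proof.
move=> h1 h2 v.
pose f (p : (bool * (H * H')) * XAYB) := ((p.1.1, ((p.1.2.1, p.2.1.1), p.2.1.2)),
   (p.1.1, ((p.1.2.2, p.2.2.1), p.2.2.2))).
have pf := psd_push f (psd_kron h1 h2).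
have : 0 <= \sum_k (lam k)%:C * qf (fun p q => N1 (f p).1 (f q).1 * N2 (f p).2 (f q).2)
     (fun p => v p.1 * tau k p.2) (fun p => v p.1 * tau k p.2).
  by apply: sumr_ge0 => k _; rewrite mulr_ge0 ?ler0c ?lam0 //; apply: pf.
congr (0 <= _); rewrite /qf.
transitivity (\sum_k \sum_p \sum_j \sum_q \sum_j' (lam k)%:C * ((v p * tau k j)^* *
   (N1 (f (p, j)).1 (f (q, j')).1 * N2 (f (p, j)).2 (f (q, j')).2) * (v q * tau k j'))).
  apply: eq_bigr => k _; rewrite sum_pair big_distrr; apply: eq_bigr => p _ /=.
  rewrite big_distrr; apply: eq_bigr => j _ /=; rewrite sum_pair big_distrr; apply: eq_bigr => q _ /=.
  by rewrite big_distrr.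
rewrite exchange_big; apply: eq_bigr => p _ /=.
under eq_bigr => k _ do rewrite exchange_big /=.
rewrite exchange_big; apply: eq_bigr => q _ /=.
rewrite /game_mx big_distrr big_distrl exchange_big; apply: eq_bigr => j _ /=.
rewrite big_distrr big_distrl exchange_big; apply: eq_bigr => j' _ /=.
rewrite /Gt !big_distrr big_distrl; apply: eq_bigr => k _ /=.
by rewrite rmorphM /=; ring.
Qed.

Lemma game_form_ge0 H H' (c : H * X -> H * X -> A -> A -> C)
   (d : H' * Y -> H' * Y -> B -> B -> C) z :
  stoch c -> stoch d -> 0 <= qf (game_mx c d) z z.
Proof.
move=> [pc _] [pd _].
have p1 := psd_push (fun p : bool * ((H * X) * A) => p.2) pc.
have p2 := psd_push (fun p : bool * ((H' * Y) * B) => p.2) pd.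
have := psd_push (fun p : H * H' => (true, p)) (game_mx_psd p1 p2); exact.
Qed.

Lemma game_domination H H' (c : H * X -> H * X -> A -> A -> C)
   (d : H' * Y -> H' * Y -> B -> B -> C) (w : R) (u v : H * H' -> C) :
  ccmap c -> ccmap d -> 0 <= w ->
  (forall (c' : H * X -> H * X -> A -> A -> C) (d' : H' * Y -> H' * Y -> B -> B -> C) z,
     stoch c' -> stoch d' -> n2 z = 1 -> qf (game_mx c' d') z z <= w%:C) ->
  n2 u = 1 -> n2 v = 1 -> `|qf (game_mx c d) u v| <= w%:C.
Proof.
move=> hc hd w0 hw u1 v1.
have w0' : 0 <= w%:C :> C by rewrite ler0c.
(* The corner theorem takes a point of [A]; if there is none, [game_mx] is an empty sum. Likewise
   for [B]. *)
have [a0|nA] := pickP (fun _ : A => true); last first.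
  rewrite /qf big1 ?normr0 // => p _; rewrite big1 // => q _; rewrite /game_mx big1 ?mulr0 ?mul0r //.
  by move=> [[x a]]; have := nA a.
have [b0|nB] := pickP (fun _ : B => true); last first.
  rewrite /qf big1 ?normr0 // => p _; rewrite big1 // => q _; rewrite /game_mx big1 ?mulr0 ?mul0r //.
  by move=> [? [y b]]; have := nB b.
have [N1 [p1 s1 e1]] := ccmap_corner a0 hc.
have [N2 [p2 s2 e2]] := ccmap_corner b0 hd.
have := psd_bool_form u v (game_mx_psd p1 p2).
have -> : qf (game_mx c d) u v = qf (game_mx (fun k k' a a' => N1 (true, (k, a)) (false, (k', a')))
    (fun k k' b b' => N2 (true, (k, b)) (false, (k', b')))) u v.
  apply: eq_qf => // p q; apply: eq_bigr => j _; apply: eq_bigr => j' _; by rewrite e1 e2.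
move=> /= le.
have : `|qf (game_mx (fun k k' a a' => N1 (true, (k, a)) (false, (k', a')))
    (fun k k' b b' => N2 (true, (k, b)) (false, (k', b')))) u v| *+ 2 <= w%:C *+ 2.
  by apply: le_trans le _; rewrite mulr2n lerD // hw.
by rewrite lerMn2r.
Qed.

(** The Choi matrix is the image of the unnormalized maximally entangled state given by [z]. *)
Lemma channel_stoch (U V : finType) (phi : U -> U -> V -> V -> C) :
  channel R U V phi -> stoch (fun (k k' : unit * U) v v' => phi k.2 k'.2 v v').
Proof.
move=> [cp tr]; split; last first.
  by move=> [[] k] [[] k'] /=; rewrite tr xpair_eqE /=; case: (k == k').
pose z (p : U * U) : C := (p.1 == p.2)%:R.
have pZ := cp _ _ (psd_rank1 z).
apply: eq_psd (psd_push (fun p : (unit * U) * V => (p.1.2, p.2)) pZ) => -[[[] x] a] [[[] x'] a'] /=.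
rewrite -(sum_delta2 (fun x x' => phi x x' a a') x x'); apply: eq_bigr => k _; apply: eq_bigr => k' _.
by rewrite /z conjC_nat mulrC.
Qed.

Lemma stoch_channel (U V : finType) (c : unit * U -> unit * U -> V -> V -> C) :
  stoch c -> channel R U V (fun u u' => c (tt, u) (tt, u')).
Proof.
move=> [pc tr]; split; last first.
  by move=> x x'; rewrite tr xpair_eqE /=; case: (x == x').
move=> I Z pZ v.
have := psd_push (fun p : (I * V) * U => ((p.1.1, p.2), ((tt, p.2), p.1.2))) (psd_kron pZ pc).
move=> /(_ (fun p => v p.1)); congr (0 <= _).
rewrite sum_pair; apply: eq_bigr => p _.
under eq_bigr => u _ do rewrite sum_pair.
rewrite exchange_big; apply: eq_bigr => q _ /=.
rewrite big_distrr big_distrl; apply: eq_bigr => u _ /=.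
by rewrite big_distrr big_distrl.
Qed.

(** * Quantum correlations and the minimal norm *)

Let values_q (r : R) := exists gam, Qq R X Y A B gam /\ r = reC R (game_value R X Y A B Rr gam xi P).

Lemma game_value_q H H' (c : H * X -> H * X -> A -> A -> C) (d : H' * Y -> H' * Y -> B -> B -> C)
    (z : H * H' -> C) (gam : corr R X Y A B) :
  (forall x x' y y' a a' b b', gam x x' y y' (a, b) (a', b') =
     \sum_h \sum_h' c (h.1, x) (h'.1, x') a a' * d (h.2, y) (h'.2, y') b b' * z h' * (z h)^*) ->
  game_value R X Y A B Rr gam xi P = qf (game_mx c d) z z.
Proof.
move=> hg; rewrite game_valueE.
under eq_bigr => j _ do under eq_bigr => j' _ do rewrite hg big_distrl /=.
under eq_bigr => j _ do rewrite exchange_big /=.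
rewrite exchange_big; apply: eq_bigr => h _ /=.
under eq_bigr => j _ do under eq_bigr => j' _ do rewrite big_distrl /=.
under eq_bigr => j _ do rewrite exchange_big /=.
rewrite exchange_big; apply: eq_bigr => h' _ /=.
rewrite /game_mx big_distrr big_distrl; apply: eq_bigr => j _ /=.
by rewrite big_distrr big_distrl; apply: eq_bigr => j' _ /=; ring.
Qed.

Lemma values_q_intro H H' (c : H * X -> H * X -> A -> A -> C) (d : H' * Y -> H' * Y -> B -> B -> C) z :
  stoch c -> stoch d -> n2 z = 1 -> values_q (complex.Re (qf (game_mx c d) z z)).
Proof.
move=> [pc tc] [pd td] z1.
exists (fun x x' y y' ab ab' => \sum_h \sum_h' c (h.1, x) (h'.1, x') ab.1 ab'.1 *
   d (h.2, y) (h'.2, y') ab.2 ab'.2 * z h' * (z h)^*).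
split; last by rewrite (@game_value_q _ _ c d z).
exists H, H', z, (fun x x' a a' h h' => c (h, x) (h', x') a a'), (fun y y' b b' h h' => d (h, y) (h', y') b b').
split; first by apply: (@complexI R); rewrite vn2E z1.
split; last split=> //.
  split; first exact: (psd_push (fun p : X * A * H => ((p.2, p.1.1), p.1.2)) pc).
  by move=> x x' h h'; rewrite tc xpair_eqE andbC; case: (_ && _).
split; first exact: (psd_push (fun p : Y * B * H' => ((p.2, p.1.1), p.1.2)) pd).
by move=> x x' h h'; rewrite td xpair_eqE andbC; case: (_ && _).
Qed.

Lemma values_q_elim r : values_q r -> exists H H' (c : H * X -> H * X -> A -> A -> C)
   (d : H' * Y -> H' * Y -> B -> B -> C) z,
  [/\ stoch c, stoch d, n2 z = 1 & r = complex.Re (qf (game_mx c d) z z)].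
Proof.
move=> [gam [[H [H' [z [E [F [z1 [[pE tE] [[pF tF] hg]]]]]]]] ->]].
pose c (k k' : H * X) a a' : C := E k.2 k'.2 a a' k.1 k'.1.
pose d (k k' : H' * Y) b b' : C := F k.2 k'.2 b b' k.1 k'.1.
exists H, H', c, d, z; split.
- split; first exact: (psd_push (fun p : (H * X) * A => ((p.1.2, p.2), p.1.1)) pE).
  by move=> [h x] [h' x']; rewrite /c /= tE xpair_eqE andbC; case: (_ && _).
- split; first exact: (psd_push (fun p : (H' * Y) * B => ((p.1.2, p.2), p.1.1)) pF).
  by move=> [h x] [h' x']; rewrite /d /= tF xpair_eqE andbC; case: (_ && _).
- by rewrite -vn2E z1 rmorph1.
rewrite (@game_value_q _ _ c d z) //.
Qed.

Lemma Re_le_norm (z : C) (w : R) : `|z| <= w%:C -> complex.Re z <= w.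
Proof.
rewrite normc_def lecR; apply: le_trans; apply: le_trans (ler_norm _) _.
by rewrite -sqrtr_sqr ler_wsqrtr // lerDl sqr_ge0.
Qed.

(** Inverse of the transposition [map_coef]: it makes a stochastic operator matrix a candidate in
    the tensor norms. *)
Let coef_map (U V H : finType) (c : H * U -> H * U -> V -> V -> C) (h h' : H) (k k' : U * V) : C :=
  c (h, k'.1) (h', k.1) k.2 k'.2.

Lemma coef_mapK (U V H : finType) (c : H * U -> H * U -> V -> V -> C) : map_coef (coef_map c) = c.
Proof.
by apply/funext => -[h u]; apply/funext => -[h' u']; apply/funext => a; apply/funext => a'.
Qed.

Lemma values_q_bound : exists w, forall r, values_q r -> r <= w.
Proof.
have [e e0 he] := game_mx_bound.
have e0' : 0 < e%:C :> C by rewrite ltcR.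
exists e^-1 => r /values_q_elim [H [H' [c [d [z [sc sd z1 ->]]]]]].
apply: Re_le_norm; have := he _ _ _ _ (stoch_ccmap sc) (stoch_ccmap sd) z z.
rewrite qfMZ z1 -mulr2n lerMn2r /= normrM (gtr0_norm e0') => le.
by rewrite fmorphV -[X in _ <= X]mul1r ler_pdivlMr // mulrC.
Qed.

Lemma omega_q_mintensor : omega R X Y A B Rr (Qq R X Y A B) xi P
    = mintensor R (X * A)%type (Y * B)%type (S1M R X A) (S1M R Y B)
        (unit : finType) (fun _ _ => G).
Proof.
have [w hw] := values_q_bound.
have [e e0 he] := game_mx_bound.
have RHSE H H' (L1 : H -> H -> X * A -> X * A -> C) (L2 : H' -> H' -> Y * B -> Y * B -> C) :
  (mn_mat R (H * H')%type (unit : finType) (fun i j (pq pq' : H * H') =>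
     \sum_k1 \sum_k1' \sum_k2 \sum_k2'
       L1 pq.1 pq'.1 k1 k1' * L2 pq.2 pq'.2 k2 k2' * G (k1, k2) (k1', k2'))) =
  opnorm R (unit * (H * H'))%type (fun p q => game_mx (map_coef L1) (map_coef L2) p.2 q.2).
  congr (opnorm R _ _); apply/funext => p; apply/funext => q; exact: game_mxE.
have lift H H' (M : H * H' -> H * H' -> C) : ctr M -> ctr (fun p q : unit * (H * H') => M p.2 q.2).
  by apply: (@ctr_inj R (unit * (H * H'))%type _ snd snd); move=> [[] ?] [[] ?] /= ->.
have qlift H H' (M : H * H' -> H * H' -> C) u v :
    qf (fun p q : unit * (H * H') => M p.2 q.2) u v = qf M (fun p => u (tt, p)) (fun p => v (tt, p)).
  rewrite /qf sum_pair (big_pred1 tt) => [|[] //]; apply: eq_bigr => p _.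
  by rewrite sum_pair (big_pred1 tt) => [|[] //].
have nlift H H' (u : unit * (H * H') -> C) : n2 (fun p => u (tt, p)) = n2 u.
  by rewrite /n2 [RHS]sum_pair (big_pred1 tt) => [|[] //].
have om0 : 0 <= omega R X Y A B Rr (Qq R X Y A B) xi P.
  apply: sup_ge0 => x /values_q_elim [H [H' [c [d [z [sc sd z1 ->]]]]]].
  by have := game_form_ge0 z sc sd; rewrite lecE => /andP[].
apply: le_anti; apply/andP; split.
  apply: sup_bounded => [|r /values_q_elim [H [H' [c [d [z [sc sd z1 ->]]]]]]].
    apply: sup_ge0 => x [H [H' [L1 [L2 [_ [_ ->]]]]]]; exact: opnorm_ge0.
  apply: le_trans (_ : opnorm R (unit * (H * H'))%type (fun p q => game_mx c d p.2 q.2) <= _).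
    apply: Re_le_norm; have := @form_le_opnorm _ (fun p q : unit * (H * H') => game_mx c d p.2 q.2) (fun p => z p.2).
    by rewrite qlift -nlift => /(_ z1).
  apply: (@sup_member _ _ e^-1); last first.
    exists H, H', (coef_map c), (coef_map d); rewrite RHSE !coef_mapK.
    by split; [|split=> //]; apply/cbS1MP; rewrite coef_mapK; apply: stoch_ccmap.
  move=> x [K [K' [L1 [L2 [/cbS1MP h1 [/cbS1MP h2 ->]]]]]]; rewrite RHSE.
  by apply: opnorm_le => //; apply: (lift K K' (fun p q => e%:C * game_mx _ _ p q)); apply: he.
apply: sup_bounded => // x [H [H' [L1 [L2 [/cbS1MP h1 [/cbS1MP h2 ->]]]]]]; rewrite RHSE.
apply: opnorm_le_form => // u v u1 v1; rewrite qlift; apply: game_domination; rewrite ?nlift //.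
move=> c d z sc sd z1; have := game_form_ge0 z sc sd => ge0.
have -> : qf (game_mx c d) z z = (complex.Re (qf (game_mx c d) z z))%:C.
  by have [? ->] := complex_realP _ (ger0_real ge0).
rewrite lecR; apply: (@sup_member _ _ w) => //; exact: values_q_intro.
Qed.

(** * Local correlations and the injective norm *)

Let values_loc (r : R) := exists gam, Qloc R X Y A B gam /\ r = reC R (game_value R X Y A B Rr gam xi P).

Let U1 := (unit * unit)%type.
(** A channel is a stochastic operator matrix on a one-dimensional space; [d1] is the unit vector of
    the product of two such spaces. *)
Let d1 : U1 -> C := delta (tt, tt).

Lemma values_loc_elim r : values_loc r -> exists n (t : 'I_n -> R) c d,
  [/\ forall i, 0 <= t i, \sum_i t i = 1, forall i : 'I_n, stoch (c i : unit * X -> unit * X -> A -> A -> C),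
      forall i : 'I_n, stoch (d i : unit * Y -> unit * Y -> B -> B -> C) &
      r = \sum_i t i * complex.Re (qf (game_mx (c i) (d i)) d1 d1)].
Proof.
move=> [gam [[n [t [phi [psi [t0 [t1 [hp [hs hg]]]]]]]] ->]].
exists n, t, (fun i k k' a a' => phi i k.2 k'.2 a a'), (fun i k k' b b' => psi i k.2 k'.2 b b').
split=> // [i|i|]; [exact: channel_stoch|exact: channel_stoch|].
have -> : game_value R X Y A B Rr gam xi P = \sum_i (t i)%:C *
   qf (game_mx (fun k k' : unit * X => phi i k.2 k'.2) (fun k k' : unit * Y => psi i k.2 k'.2)) d1 d1.
  rewrite game_valueE.
  under eq_bigr => j _ do under eq_bigr => j' _ do rewrite hg big_distrl /=.
  under eq_bigr => j _ do rewrite exchange_big /=.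
  rewrite exchange_big; apply: eq_bigr => i _ /=; rewrite qf_delta /game_mx big_distrr.
  apply: eq_bigr => j _ /=; rewrite big_distrr; apply: eq_bigr => j' _ /=.
  by rewrite -[rC R (t i)]/((t i)%:C); ring.
have ReM (x : R) (z : C) : complex.Re (x%:C * z) = x * complex.Re z.
  by case: z => a b /=; rewrite mul0r subr0.
rewrite -[reC R _]/(complex.Re _).
have ReS (F : 'I_n -> C) : complex.Re (\sum_i F i) = \sum_i complex.Re (F i).
  by apply: (big_morph (@complex.Re R)) => // -[? ?] [? ?].
by rewrite ReS; apply: eq_bigr => i _; rewrite ReM.
Qed.

(** The unit vector [z] is a mere phase and drops out, leaving a convex combination with a single
    term. *)
Lemma values_loc_intro (c : unit * X -> unit * X -> A -> A -> C) (d : unit * Y -> unit * Y -> B -> B -> C) z :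
  stoch c -> stoch d -> n2 z = 1 -> values_loc (complex.Re (qf (game_mx c d) z z)).
Proof.
move=> sc sd z1.
exists (fun x x' y y' ab ab' => \sum_(i < 1) rC R 1 * c (tt, x) (tt, x') ab.1 ab'.1 * d (tt, y) (tt, y') ab.2 ab'.2).
split.
  exists 1%N, (fun=> 1), (fun _ x x' => c (tt, x) (tt, x')), (fun _ y y' => d (tt, y) (tt, y')).
  split=> //; split; first by rewrite big_ord1.
  by split; [move=> _; apply: stoch_channel|split=> // _; apply: stoch_channel].
rewrite (@game_value_q _ _ c d z) // => x x' y y' a a' b b'.
rewrite big_ord1 !sum_pair !(big_pred1 tt) => [|[] //|[] //].
rewrite !sum_pair !(big_pred1 tt) => [|[] //|[] //] /=.
have -> : rC R 1 = 1 by [].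
move: z1; rewrite /n2 sum_pair !(big_pred1 tt) => [|[] //|[] //] z1.
by rewrite mul1r -mulrA [z _ * _]mulrC z1 mulr1.
Qed.

Lemma omega_loc_epsnorm : omega R X Y A B Rr (Qloc R X Y A B) xi P
    = epsnorm R (X * A)%type (Y * B)%type (S1M R X A) (S1M R Y B) G.
Proof.
have [w hw] := values_q_bound.
have [e e0 he] := game_mx_bound.
have d11 : n2 d1 = 1 by exact: n2_delta.
have form0 c d z : stoch c -> stoch d -> 0 <= complex.Re (qf (game_mx c d : U1 -> U1 -> C) z z).
  by move=> sc sd; have := game_form_ge0 z sc sd; rewrite lecE => /andP[].
(* A local value is an average of quantum values on one-dimensional spaces. *)
have bound r : values_loc r -> r <= w.
  move=> /values_loc_elim [n [t [c [d [t0 t1 sc sd ->]]]]].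
  rewrite -[w]mul1r -t1 big_distrl; apply: ler_sum => i _; apply: ler_wpM2l => //.
  by apply: hw; apply: values_q_intro.
have om0 : 0 <= omega R X Y A B Rr (Qloc R X Y A B) xi P.
  apply: sup_ge0 => x /values_loc_elim [n [t [c [d [t0 t1 sc sd ->]]]]].
  by apply: sumr_ge0 => i _; rewrite mulr_ge0 // form0.
have RHSE (f : X * A -> X * A -> C) (g : Y * B -> Y * B -> C) :
  cabs R (\sum_k1 \sum_k1' \sum_k2 \sum_k2' f k1 k1' * g k2 k2' * G (k1, k2) (k1', k2'))
  = cabs R (qf (game_mx (map_coef (fun _ _ : unit => f)) (map_coef (fun _ _ : unit => g))) d1 d1).
  by rewrite qf_delta -game_mxE.
have eps0 : 0 <= epsnorm R (X * A)%type (Y * B)%type (S1M R X A) (S1M R Y B) G.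
  by apply: sup_ge0 => x [f [g [_ [_ ->]]]]; apply: sqrtr_ge0.
have dom f g : dualnorm R (X * A)%type (S1M R X A) f <= 1 -> dualnorm R (Y * B)%type (S1M R Y B) g <= 1 ->
  cabs R (qf (game_mx (map_coef (fun _ _ : unit => f)) (map_coef (fun _ _ : unit => g))) d1 d1)
  <= omega R X Y A B Rr (Qloc R X Y A B) xi P.
  move=> /dualnorm_ccmap hf /dualnorm_ccmap hg; rewrite -lecR cabsE.
  apply: game_domination => // c d z sc sd z1.
  have -> : qf (game_mx c d) z z = (complex.Re (qf (game_mx c d) z z))%:C.
    by have [x ->] := complex_realP _ (ger0_real (game_form_ge0 z sc sd)).
  rewrite lecR; apply: (@sup_member _ _ w) => //; exact: values_loc_intro.
apply: le_anti; apply/andP; split; last first.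
  apply: sup_bounded => // x [f [g [hf [hg ->]]]]; rewrite RHSE; exact: dom.
apply: sup_bounded => // r /values_loc_elim [n [t [c [d [t0 t1 sc sd ->]]]]].
rewrite -[epsnorm _ _ _ _ _ _]mul1r -t1 big_distrl; apply: ler_sum => i _; apply: ler_wpM2l => //=.
apply: (@le_trans _ _ (cabs R (qf (game_mx (c i) (d i)) d1 d1))).
  by apply: Re_le_norm; rewrite cabsE.
apply: (@sup_member _ _ (omega R X Y A B Rr (Qloc R X Y A B) xi P)).
  by move=> x [f [g [hf [hg ->]]]]; rewrite RHSE; exact: dom.
exists (coef_map (c i) tt tt), (coef_map (d i) tt tt); rewrite RHSE.
have E (T V : finType) (h : unit * T -> unit * T -> V -> V -> C) :
  map_coef (fun _ _ : unit => coef_map h tt tt) = h.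
  by apply/funext => -[[] u]; apply/funext => -[[] u']; apply/funext => a; apply/funext => a'.
by rewrite !E; split; [|split=> //]; apply: ccmap_dualnorm; rewrite E; apply: stoch_ccmap.
Qed.

End Game.

Unset Implicit Arguments.

Theorem theorem6p2 (R : realType) (X Y A B Rr : finType)
  (xi : X * Y * Rr -> R[i])
  (Kk : finType) (lam : Kk -> R) (gma : Kk -> A * B * Rr -> R[i]) :
  vn2 R _ xi = 1 ->
  (forall k l : Kk, \sum_(s : A * B * Rr) gma k s * (gma l s)^* = if k == l then 1 else 0) ->
  (forall k, 0 <= lam k <= 1) ->
  let P := mkP R Kk (A * B * Rr)%type lam gma in
  let G := GG R X Y A B Rr xi P in
  omega R X Y A B Rr (Qloc R X Y A B) xi P
    = epsnorm R (X * A)%type (Y * B)%type (S1M R X A) (S1M R Y B) G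
  /\
  omega R X Y A B Rr (Qq R X Y A B) xi P
    = mintensor R (X * A)%type (Y * B)%type (S1M R X A) (S1M R Y B)
        (unit : finType) (fun _ _ => G).
Proof.
move=> _ _ hlam P G.
have lam0 k : 0 <= lam k by case/andP: (hlam k).
by split; [apply: omega_loc_epsnorm | apply: omega_q_mintensor].
Qed.
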